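(* Let $K$ be a $1$-symmetric convex body in $\mathbb{R}^n$. Then the function $$a \mapsto V_K(a) = \frac{\|a\|_1}{|a|}\,\mathrm{vol}_{n-1}(K \cap a^\perp)$$ is Schur concave on $\mathbb{R}_+^n \setminus \{0\}$, that is, for all $x, y \in \mathbb{R}_+^n\setminus\{0\}$ with $x \prec y$ we have $V_K(x) \geq V_K(y)$. In particular, the constant $$\beta_K = \max_{a \in \mathbb{R}^n\setminus \{0\}}\ \max_{t \in \mathbb{R}}\ \frac{\|a\|_1}{|a|}\,\mathrm{vol}_{n-1}\big(K \cap (ta + a^\perp)\big)$$ satisfies $\beta_K = \sqrt{n}\,\mathrm{vol}_{n-1}(K \cap (1,\dots,1)^\perp)$.
   Context: A convex body in $\mathbb{R}^n$ is a compact convex set with nonempty interior. It is called $1$-symmetric if it is symmetric with respect to every coordinate hyperplane $\{x \in \mathbb{R}^n : x_j = 0\}$, $j \leq n$, and is invariant under permutations of the coordinates. $\mathbb{R}_+ = [0,\infty)$; $|x| = \|x\|_2$ is the Euclidean norm and $\|x\|_1 = \sum_j |x_j|$; $a^\perp = \{x \in \mathbb{R}^n : \langle x, a\rangle = 0\}$; $\mathrm{vol}_{n-1}$ is the $(n-1)$-dimensional volume (within hyperplanes). For $a \in \mathbb{R}_+^n$, $a^* = (a_1^*, \dots, a_n^* )$ denotes its nonincreasing rearrangement, $a_1^* \geq \dots \geq a_n^*$. For $a, b \in \mathbb{R}_+^n$, $a \prec b$ ($a$ is majorized by $b$) means $\sum_{i=1}^n a_i = \sum_{i=1}^n b_i$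 and $\sum_{i=1}^k a_i^* \leq \sum_{i=1}^k b_i^*$ for every $k \leq n-1$. A function $\varphi$ on a subset $D$ of $\mathbb{R}_+^n$ is Schur concave if $x \prec y$ implies $\varphi(x) \geq \varphi(y)$ for $x,y\in D$. *)

(* Defs.v *)
From HB Require Import structures.
From mathcomp Require Import all_boot all_order all_algebra.
From mathcomp Require Import all_fingroup.
From mathcomp Require Import all_classical all_reals all_analysis.

Set Implicit Arguments.
Unset Strict Implicit.
Unset Printing Implicit Defensive.

Import Order.TTheory GRing.Theory Num.Theory.
Import numFieldNormedType.Exports.

Local Open Scope classical_set_scope.
Local Open Scope ring_scope.

(** Lebesgue measure on R^m is the iterated product measure, transported to
    [m.-tuple R] along the bijection (s, x) |-> x :: s; on R^0 it is the Dirac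
    mass. *)

Section lebesgue_tuple.
Context (R : realType).
Notation RT := (measurableTypeR R).

Definition consp (m : nat) (p : m.-tuple RT * RT) : m.+1.-tuple RT :=
  [the m.+1.-tuple RT of p.2 :: p.1].

Lemma measurable_consp (m : nat) : measurable_fun setT (@consp m).
Proof. by apply: measurable_cons. Qed.

Definition lebesgue_tuple_step (m : nat)
    (mu : {measure set (m.-tuple RT) -> \bar R}) :
    set (m.+1.-tuple RT) -> \bar R :=
  pushforward (mu \x @lebesgue_measure R)%E (@consp m).

Let step_measure m (mu : {measure set (m.-tuple RT) -> \bar R}) :
  {measure set (m.+1.-tuple RT) -> \bar R} :=
  measure_function_pushforward__canonical__measure_function_Measure
    (mu \x @lebesgue_measure R)%E (@measurable_consp m).

HB.instance Definition _ (m : nat)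
    (mu : {measure set (m.-tuple RT) -> \bar R}) :=
  isMeasure.Build _ _ _ (lebesgue_tuple_step mu)
    (measure0 (step_measure mu)) (measure_ge0 (step_measure mu))
    (@measure_semi_sigma_additive _ _ _ (step_measure mu)).

Fixpoint lebesgue_tuple (m : nat) : {measure set (m.-tuple RT) -> \bar R} :=
  if m is m'.+1 then lebesgue_tuple_step (lebesgue_tuple m') else \d_[tuple].

End lebesgue_tuple.

Definition lebesgue_rV (R : realType) (m : nat) (A : set 'rV[R]_m) : \bar R :=
  lebesgue_tuple R m [set s | A (\row_i tnth s i)].

Section euclidean.
Context (R : realType) (n : nat).
Implicit Types (a x y : 'rV[R]_n) (A K : set 'rV[R]_n).

Definition dot x y : R := \sum_(i < n) x 0 i * y 0 i.
Definition norm1 x : R := \sum_(i < n) `|x 0 i|.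
Definition norm2 x : R := Num.sqrt (dot x x).

Definition orth a : set 'rV[R]_n := [set x | dot x a = 0].
Definition translate x A : set 'rV[R]_n := [set x + z | z in A].

(** The rows of [hframe a] are an orthonormal basis of [orth a] (for a != 0),
    chosen arbitrarily: another choice changes the coordinates below by a linear
    isometry of R^(n-1), which preserves Lebesgue measure. *)
Definition hframe a : 'M[R]_(n.-1, n) :=
  xget 0 [set U | U *m U^T = 1%:M /\ U *m a^T = 0].

(** (n-1)-dimensional volume of a set [A] contained in a hyperplane parallel to
    [orth a]: on such a hyperplane, x |-> x *m (hframe a)^T is an isometry onto
    R^(n-1). *)
Definition hyperplane_vol a A : \bar R :=
  lebesgue_rV [set x *m (hframe a)^T | x in A].

Definition convex_body K := [/\ compact K, convex_set K & K° !=set0].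

Definition reflect_coord (j : 'I_n) x : 'rV[R]_n :=
  \row_i (if i == j then - x 0 i else x 0 i).

Definition one_symmetric K :=
  (forall j : 'I_n, [set reflect_coord j x | x in K] = K) /\
  (forall s : 'S_n, [set col_perm s x | x in K] = K).

Definition nonneg_orthant : set 'rV[R]_n := [set x | forall i, 0 <= x 0 i].

(** Nonincreasing rearrangement, indexed from 0. *)
Definition rearr x : seq R := sort >=%R [seq x 0 i | i <- enum 'I_n].

Definition majorized x y :=
  \sum_(i < n) x 0 i = \sum_(i < n) y 0 i /\
  (forall k : nat, (k <= n.-1)%N ->
    \sum_(i < k) (rearr x)`_i <= \sum_(i < k) (rearr y)`_i).

(** [D] is meant to be a subset of [nonneg_orthant]. *)
Definition schur_concave (D : set 'rV[R]_n) (phi : 'rV[R]_n -> \bar R) :=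
  forall x y, D x -> D y -> majorized x y -> (phi y <= phi x)%E.

Definition V K a : \bar R :=
  ((norm1 a / norm2 a)%:E * hyperplane_vol a (K `&` orth a))%E.

Definition V_shift K a (t : R) : \bar R :=
  ((norm1 a / norm2 a)%:E *
   hyperplane_vol a (K `&` translate (t *: a) (orth a)))%E.

Definition is_max (S : set \bar R) (m : \bar R) := S m /\ ubound S m.

(** [ereal_sup] stands for max here; attainment has to be stated separately,
    through [is_max]. *)
Definition beta_at K a : \bar R := ereal_sup [set V_shift K a t | t in setT].

Definition beta K : \bar R := ereal_sup [set beta_at K a | a in ~` [set 0]].

End euclidean.

(* Main.v *)
From HB Require Import structures.
From mathcomp Require Import fingroup perm.
Require Import Defs.
From mathcomp Require Import all_boot all_order all_algebra.
From mathcomp Require Import all_classical all_reals all_analysis.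
From mathcomp Require Import measurable_realfun ring lra.

Set Implicit Arguments.
Unset Strict Implicit.
Unset Printing Implicit Defensive.

Import Order.TTheory GRing.Theory Num.Theory.
Import numFieldNormedType.Exports.

Local Open Scope classical_set_scope.
Local Open Scope ring_scope.

(** Put f(a) = vol(K `&` a^perp) / |a|, so that V_K(a) = |a|_1 f(a). Majorization
    between vectors with nonnegative coordinates is generated by permutations and
    by transfers that bring two coordinates y_j, y_k closer together without
    changing their sum ([sorted_psum_le], [majorized_schur]). Permutations
    preserve V_K because they are isometries preserving K ([V_perm]), and |a|_1 is
    constant along a transfer, so it remains to see that f increases along it
    ([V_robin_hood]).

    A transfer moves along a line: with the unit vector
    e = (e_j - e_k) / sqrt 2, it replaces a = b + t e by b + s e, where b is
    orthogonal to e and |s| <= |t|. Cutting the hyperplane a^perp by the level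
    sets of x |-> <x, e> gives ([section_volume_slices])

      f(b + t e) = 1/|b| * \int_x g_x(- x t / |b|^2) dx,
      g_x(u) = vol_(n-2) {v in (e, b)^perp | x e + u b + v \in K},

    in which t enters only through the argument of g_x. The body K is stable under
    central symmetry and under the exchange of coordinates j and k, hence under
    their product, which fixes e and is -1 on e^perp. Each slice of K by a level
    set is therefore a centrally symmetric convex set, and by Brunn's theorem g_x
    is even and nonincreasing in |u| ([brunn_symmetric]). The integrands are thus
    ordered pointwise, which is [reflection_section_mono]. Busemann's theorem,
    that 1/f is a norm, gives the same monotonicity without this symmetry of
    the slices, but lies deeper than Brunn's.

    Brunn's theorem for a symmetric body also shows that central sections are the
    largest among parallel ones ([V_shift_le]), so beta_K is the supremum of V_K.
    Sign changes of coordinates preserve V_K ([V_abs]), and the constant vector is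
    majorized by every nonnegative vector with the same sum
    ([sorted_mean_psum]); as V_K is homogeneous of degree 0, its maximum is
    attained at (1, ..., 1) ([V_le_const]).

    The volume input is the multiplicative Brunn-Minkowski inequality
    ([brunn_minkowski]), obtained by induction on the dimension: the volumes of
    the slices of A, B and C satisfy the hypothesis of the one-dimensional
    Prekopa-Leindler inequality ([prekopa_leindler_line]), itself a consequence of
    the case of subsets of the line through layer-cake integration. Volumes in
    hyperplanes are computed in an orthonormal frame chosen arbitrarily; they can
    be computed in any other one ([hyperplane_vol_frame]) because Lebesgue measure
    is invariant under orthogonal matrices ([lebesgue_rV_orth]). *)

(** * Affine changes of variable on the line *)

Section affine.
Context (R : realType).
Notation lam := (@lebesgue_measure R).

Lemma measurable_affine (c d : R) :
  measurable_fun setT (fun x : measurableTypeR R => c * x + d : measurableTypeR R).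
Proof. by apply: measurable_funD => //; apply: measurable_funM. Qed.

Lemma lebesgue_affine (c d : R) (A : set (measurableTypeR R)) :
  c != 0 -> measurable A ->
  lam A = (`|c|%R%:E * lam [set x | A (c * x + d)%R])%E.
Proof.
move=> c0 mA.
have c_ge0 : 0 <= `|c| by [].
pose mu := mscale (NngNum c_ge0)
  (measure_function_pushforward__canonical__measure_function_Measure
    lam (measurable_affine c d)).
apply: (@lebesgue_measure_unique _ mu) => // _ [[a b] _ <-] /=.
rewrite /mu /mscale /= /pushforward !lebesgue_measure_itv /=.
have [cn|cp] := ltP c 0.
- rewrite [X in lam X](_ : _ = `[(b - d) / c, (a - d) / c[%classic); last first.
    apply/seteqP; split => x /=; rewrite !in_itv /= ler_ndivrMr // ltr_ndivlMr //;
      move=> /andP[? ?]; apply/andP; split; lra.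
  rewrite lebesgue_measure_itv /= !lte_fin ltr_nM2r ?invr_lt0 // ltrD2r.
  case: ifPn => // ab; last by rewrite mule0.
  rewrite -!EFinD -EFinM ltr0_norm //; congr (_%:E); by field.
- have {}cp : 0 < c by rewrite lt_def c0.
  rewrite [X in lam X](_ : _ = `](a - d) / c, (b - d) / c]%classic); last first.
    apply/seteqP; split => x /=; rewrite !in_itv /= ltr_pdivrMr // ler_pdivlMr //;
      move=> /andP[? ?]; apply/andP; split; lra.
  rewrite lebesgue_measure_itv /= !lte_fin ltr_pM2r ?invr_gt0 // ltrD2r.
  case: ifPn => // ab; last by rewrite mule0.
  rewrite -!EFinD -EFinM gtr0_norm //; congr (_%:E); by field.
Qed.

Lemma integral_affine (c d : R) (f : measurableTypeR R -> \bar R) :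
  c != 0 -> measurable_fun setT f -> (forall x, 0 <= f x)%E ->
  (\int[lam]_x f x = `|c|%:E * \int[lam]_x f (c * x + d)%R)%E.
Proof.
move=> c0 mf f0.
have c_ge0 : 0 <= `|c| by [].
pose mu := mscale (NngNum c_ge0)
  (measure_function_pushforward__canonical__measure_function_Measure
    lam (measurable_affine c d)).
transitivity (\int[mu]_x f x)%E.
  by apply: eq_measure_integral => A mA _; exact: (lebesgue_affine d c0 mA).
rewrite ge0_integral_mscale //=.
by rewrite ge0_integral_pushforward //; exact: measurable_affine.
Qed.

End affine.

(** * The Brunn-Minkowski and Prekopa-Leindler inequalities on the line *)

Section tonelli_set.
Context d1 d2 (T1 : measurableType d1) (T2 : measurableType d2) (R : realType).
Variables (m1 : {sigma_finite_measure set T1 -> \bar R})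
  (m2 : {sigma_finite_measure set T2 -> \bar R}).

Lemma tonelli_set (S : set (T1 * T2)) : measurable S ->
  (\int[m1]_x m2 [set y | S (x, y)] = \int[m2]_y m1 [set x | S (x, y)])%E.
Proof.
move=> mS.
have /= E := @product_measure_unique _ _ _ _ _ m1 m2 (m1 \x^ m2)%E
  (product_measure2E m1 m2) _ mS.
transitivity ((m1 \x m2) S)%E.
  by apply: eq_integral => x _ /=; rewrite xsectionE.
by rewrite E; apply: eq_integral => y _ /=; rewrite ysectionE.
Qed.

Lemma product_measure_swap (S : set (T1 * T2)) : measurable S ->
  ((m1 \x m2) S = \int[m2]_y m1 [set x | S (x, y)])%E.
Proof.
move=> mS; rewrite -tonelli_set //.
by apply: eq_integral => x _ /=; rewrite xsectionE.
Qed.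

End tonelli_set.

Section line.
Context (R : realType).
Notation RT := (measurableTypeR R).
Notation lam := (@lebesgue_measure R).

Lemma measurable_hypograph (f : RT -> R) : measurable_fun setT f ->
  measurable [set p : RT * RT | 0 < p.2 < f p.1].
Proof.
move=> mf.
have -> : [set p : RT * RT | 0 < p.2 < f p.1] =
    [set p : RT * RT | 0 < p.2] `&` [set p | p.2 < f p.1].
  by apply/seteqP; split => -[x t] /=; [move/andP | move=> [? ?]; apply/andP].
apply: measurableI.
- rewrite -[X in measurable X]setTI.
  exact: (measurable_fun_ltr (measurable_cst _) measurable_snd measurableT
    (Y := [set true])).
- rewrite -[X in measurable X]setTI.
  exact: (measurable_fun_ltr measurable_snd (measurableT_comp mf measurable_fst)
    measurableT (Y := [set true])).
Qed.

(** Both sides are the area of the region between the graph of f and the axis,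
    sliced in the two directions. *)
Lemma integral_layers (f : RT -> R) : measurable_fun setT f ->
  (forall x, 0 <= f x) ->
  (\int[lam]_x (f x)%:E = \int[lam]_t lam [set x | 0 < t < f x]%R)%E.
Proof.
move=> mf f0; have mS := measurable_hypograph mf.
rewrite -(tonelli_set lam lam mS).
apply: eq_integral => x _ /=.
have -> : [set y : RT | 0 < y < f x] = `]0, f x[%classic.
  by apply/seteqP; split => t; rewrite /= in_itv.
rewrite lebesgue_measure_itv /= lte_fin.
by case: ltP => fx; [rewrite oppr0 adde0 | congr (_%:E); apply/eqP; rewrite eq_le f0 fx].
Qed.

Variables (p q : R).
Hypotheses (p0 : 0 < p) (q0 : 0 < q) (pq : p + q = 1).

(** Young's inequality for a^p and b^q with exponents 1/p and 1/q. *)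
Lemma powR_weighted_AMGM (a b : R) : 0 <= a -> 0 <= b -> a `^ p * b `^ q <= p * a + q * b.
Proof.
move=> a0 b0.
have := @conjugate_powR _ (a `^ p) (b `^ q) p^-1 q^-1 (powR_ge0 _ _) (powR_ge0 _ _).
rewrite !invr_gt0 !invrK -!powRrM !divff ?gt_eqF // !powRr1 //.
by rewrite [a * p]mulrC [b * q]mulrC => ->.
Qed.

(** If a is the maximum of A and b the minimum of B, then p A + q b and p a + q B
    lie in C and meet at the single point p a + q b, so their lengths add up. The
    extrema need not be attained, whence the approximation within e. *)
Lemma brunn_minkowski_line (A B C : set RT) (r : R) :
  measurable A -> measurable B -> measurable C ->
  (forall x, A x -> `|x| <= r) -> (forall x, B x -> `|x| <= r) ->
  A !=set0 -> B !=set0 ->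
  (forall x y, A x -> B y -> C (p * x + q * y)) ->
  (p%:E * lam A + q%:E * lam B <= lam C)%E.
Proof.
move=> mA mB mC Ar Br A0 B0 ABC.
have Asup : has_sup A.
  by split => //; exists r => x /Ar; rewrite ler_norml => /andP[].
have Binf : has_inf B.
  by split => //; exists (- r) => x /Br; rewrite ler_norml => /andP[].
apply/lee_addgt0Pr => e e0.
have [a Aa ae] := sup_adherent e0 Asup.
have [b Bb be] := inf_adherent e0 Binf.
pose A' := A `&` [set x | x < a].
pose B' := B `&` [set x | b <= x].
have mA' : measurable A'.
  by apply: measurableI => //; rewrite -set_itvNyo; exact: measurable_itv.
have mB' : measurable B'.
  by apply: measurableI => //; rewrite -set_itvcy; exact: measurable_itv.
have lamA : (lam A <= lam A' + e%:E)%E.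
  have mI : measurable `[a, a + e]%classic by exact: measurable_itv.
  have <- : lam `[a, a + e]%classic = e%:E.
    by rewrite lebesgue_measure_itv /= lte_fin ltrDl e0 -EFinD addrAC subrr add0r.
  apply: le_trans (measureU2 lam mA' mI).
  apply: le_measure; rewrite ?inE //; first exact: measurableU.
  move=> x Ax; have [xa|ax] := ltP x a; [by left | right].
  rewrite /= in_itv /= ax /=.
  have : x <= sup A by apply: (sup_upper_bound Asup).
  by move=> h; apply: (le_trans h); lra.
have lamB : (lam B <= lam B' + e%:E)%E.
  have mI : measurable `[b - e, b]%classic by exact: measurable_itv.
  have <- : lam `[b - e, b]%classic = e%:E.
    rewrite lebesgue_measure_itv /= lte_fin ltrBlDr ltrDl e0 -EFinD.
    by congr (_%:E); ring.
  apply: le_trans (measureU2 lam mB' mI).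
  apply: le_measure; rewrite ?inE //; first exact: measurableU.
  move=> x Bx; have [bx|xb] := leP b x; [by left | right].
  rewrite /= in_itv /= (ltW xb) andbT.
  have : inf B <= x by apply: ge_inf => //; case: Binf.
  by move=> h; apply: (le_trans _ h); lra.
(* The sets p A' + q b and p a + q B', separated by the point p a + q b. *)
pose A1 := [set z : RT | A' (p^-1 * z + - (q * b / p))].
pose B1 := [set z : RT | B' (q^-1 * z + - (p * a / q))].
have mA1 : measurable A1.
  by rewrite -[A1]setTI; apply: measurable_affine.
have mB1 : measurable B1.
  by rewrite -[B1]setTI; apply: measurable_affine.
have lamA1 : (p%:E * lam A' = lam A1)%E.
  rewrite (lebesgue_affine (- (q * b / p)) (invr_neq0 (lt0r_neq0 p0)) mA').
  by rewrite muleA gtr0_norm ?invr_gt0 // -EFinM divff ?gt_eqF // mul1e.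
have lamB1 : (q%:E * lam B' = lam B1)%E.
  rewrite (lebesgue_affine (- (p * a / q)) (invr_neq0 (lt0r_neq0 q0)) mB').
  by rewrite muleA gtr0_norm ?invr_gt0 // -EFinM divff ?gt_eqF // mul1e.
have pE z : p * (p^-1 * z + - (q * b / p)) = z - q * b by field; rewrite gt_eqF.
have qE z : q * (q^-1 * z + - (p * a / q)) = z - p * a by field; rewrite gt_eqF.
have A1B1 : A1 `&` B1 = set0.
  apply/seteqP; split => // z [[_ /= za] [_ /= bz]].
  move: za bz; rewrite -(ltr_pM2l p0) -(ler_pM2l q0) pE qE; lra.
have A1C : A1 `|` B1 `<=` C.
  move=> z [[Az _]|[Bz _]].
  - by have := ABC _ _ Az Bb; rewrite pE subrK.
  - by have := ABC _ _ Aa Bz; rewrite qE addrC subrK.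
apply: (@le_trans _ _ (lam A1 + lam B1 + e%:E)%E).
  rewrite -lamA1 -lamB1.
  apply: (@le_trans _ _ (p%:E * (lam A' + e%:E) + q%:E * (lam B' + e%:E))%E).
    by apply: leeD; apply: lee_wpmul2l => //; rewrite lee_fin ltW.
  rewrite !ge0_muleDr ?lee_fin ?(ltW e0) // addeACA leeD2l // -!EFinM -EFinD lee_fin.
  by rewrite -mulrDl pq mul1r.
rewrite leeD2r // -measureU //.
by apply: le_measure; rewrite ?inE //; exact: measurableU.
Qed.

(** For 0 < t < 1 the superlevel sets {f > t} and {g > t} are nonempty, this being
    what the normalization to supremum 1 is for, and the superlevel set of h
    contains their p, q combination since t^p t^q = t. The inequality for subsets
    of the line then bounds the layers, which are integrated over t. *)
Lemma prekopa_leindler_line_normalized (f g h : RT -> R) (r : R) :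
  measurable_fun setT f -> measurable_fun setT g -> measurable_fun setT h ->
  (forall x, 0 <= f x <= 1) -> (forall x, 0 <= g x <= 1) -> (forall x, 0 <= h x) ->
  (forall x, f x != 0 -> `|x| <= r) -> (forall x, g x != 0 -> `|x| <= r) ->
  (forall t, t < 1 -> exists x, t < f x) -> (forall t, t < 1 -> exists x, t < g x) ->
  (forall x y, f x `^ p * g y `^ q <= h (p * x + q * y)) ->
  (p%:E * \int[lam]_x (f x)%:E + q%:E * \int[lam]_x (g x)%:E <=
   \int[lam]_x (h x)%:E)%E.
Proof.
move=> mf mg mh f01 g01 h0 fr gr fs gs fgh.
have mlayer (k : RT -> R) t : measurable_fun setT k ->
    measurable [set x | 0 < t < k x].
  move=> mk; have [t0|t0] := ltP 0 t.
    rewrite -[X in measurable X]setTI.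
    exact: (measurable_fun_ltr (measurable_cst t) mk measurableT
      (Y := [set true])).
  rewrite [X in measurable X](_ : _ = set0) //.
  by apply/seteqP; split.
have mlam (k : RT -> R) : measurable_fun setT k ->
    measurable_fun setT (fun t : RT => lam [set x | 0 < t < k x]).
  move=> mk; have := measurable_fun_ysection lam (measurable_hypograph mk).
  by apply: eq_measurable_fun => t _ /=; rewrite ysectionE.
rewrite !integral_layers //; try by move=> x; case/andP: (f01 x); case/andP: (g01 x).
rewrite -!ge0_integralZl ?lee_fin ?(ltW p0) ?(ltW q0) //; try exact: mlam.
rewrite -ge0_integralD //; last 4 first.
- by move=> t _; rewrite mule_ge0 // lee_fin ltW.
- by apply: measurable_funeM; exact: mlam.
- by move=> t _; rewrite mule_ge0 // lee_fin ltW.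
- by apply: measurable_funeM; exact: mlam.
apply: ge0_le_integral => //; last 2 first.
- exact: mlam.
- move=> t _.
  have [t01|nt] := boolP (0 < t < 1); last first.
    have k0 (k : RT -> R) : (forall x, 0 <= k x <= 1) -> [set x | 0 < t < k x] = set0.
      move=> k01; apply/seteqP; split => // x /= /andP[t0 tk].
      move: nt; rewrite t0 /= -leNgt => t1.
      by have /andP[_ /(lt_le_trans tk)] := k01 x; rewrite ltNge t1.
    by rewrite (k0 f) // (k0 g) // measure0 !mule0 adde0.
  have /andP[t0 t1] := t01.
  apply: (@brunn_minkowski_line _ _ _ r); try exact: mlayer.
  - by move=> x /= /andP[_ tf]; apply: fr; rewrite gt_eqF // (lt_trans t0).
  - by move=> x /= /andP[_ tf]; apply: gr; rewrite gt_eqF // (lt_trans t0).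
  - by have [x tx] := fs t t1; exists x; rewrite /= t0.
  - by have [x tx] := gs t t1; exists x; rewrite /= t0.
  - move=> x y /= /andP[_ tf] /andP[_ tg]; rewrite t0 /=.
    apply: lt_le_trans (fgh x y).
    have {1}-> : t = t `^ p * t `^ q.
      by rewrite -powRD ?pq ?powRr1 ?(ltW t0) // gt_eqF ?implybT.
    apply: ltr_pM; rewrite ?powR_ge0 //;
      by apply: gt0_ltr_powR; rewrite ?nnegrE ?ltW // (lt_trans t0).
- by move=> t _; rewrite adde_ge0 // mule_ge0 // lee_fin ltW.
- by apply: emeasurable_funD; apply: measurable_funeM; exact: mlam.
Qed.

(** Dividing f, g by their suprema s, u and h by c = s^p u^q reduces to the
    normalized case; there the weighted arithmetic mean obtained dominates the
    geometric one. *)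
Lemma prekopa_leindler_line (f g h : RT -> R) (r M : R) :
  measurable_fun setT f -> measurable_fun setT g -> measurable_fun setT h ->
  (forall x, 0 <= f x <= M) -> (forall x, 0 <= g x <= M) -> (forall x, 0 <= h x) ->
  (forall x, f x != 0 -> `|x| <= r) -> (forall x, g x != 0 -> `|x| <= r) ->
  (forall x y, f x `^ p * g y `^ q <= h (p * x + q * y)) ->
  (((fine (\int[lam]_x (f x)%:E)) `^ p * (fine (\int[lam]_x (g x)%:E)) `^ q)%:E <=
   \int[lam]_x (h x)%:E)%E.
Proof.
move=> mf mg mh f0M g0M h0 fr gr fgh.
have int_ge0 (k : RT -> R) : (forall x, 0 <= k x) ->
    (0 <= \int[lam]_x (k x)%:E)%E.
  by move=> k0; apply: integral_ge0 => x _; rewrite lee_fin.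
have int0 (k : RT -> R) : (forall x, k x = 0) -> fine (\int[lam]_x (k x)%:E) = 0.
  by move=> k0; rewrite integral0_eq // => x _; rewrite k0.
have suprange (k : RT -> R) : (forall x, 0 <= k x <= M) ->
    (forall x, k x = 0) \/ exists2 s, 0 < s & (forall x, k x <= s) /\
      (forall t, t < s -> exists x, t < k x).
  move=> k0M; have [[x kx]|/forallNP k0] := pselect (exists x, k x != 0).
  - right; have hs : has_sup (range k).
      split; first by exists (k x), x.
      by exists M => _ [y _ <-]; case/andP: (k0M y).
    have ub y : k y <= sup (range k) by apply: (sup_upper_bound hs); exists y.
    exists (sup (range k)).
      apply: lt_le_trans (ub x); rewrite lt_def kx.
      by case/andP: (k0M x).
    split => // t ts; have st0 : 0 < sup (range k) - t by rewrite subr_gt0.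
    have [_ [y _ <-]] := sup_adherent st0 hs.
    by rewrite subKr => ty; exists y.
  - by left => y; apply/eqP; rewrite -[_ == _]negbK; apply/negP; exact: k0.
have [f0|[s s0 [fs sf]]] := suprange _ f0M.
  by rewrite int0 // powR0 ?gt_eqF // mul0r int_ge0.
have [g0|[u u0 [gu ug]]] := suprange _ g0M.
  by rewrite (int0 g) // powR0 ?gt_eqF // mulr0 int_ge0.
(* The scaling factor forced on h by those of f and g. *)
pose c := s `^ p * u `^ q.
have c0 : 0 < c by rewrite mulr_gt0 // powR_gt0.
have scale (k : RT -> R) v : 0 < v -> measurable_fun setT k -> (forall x, 0 <= k x) ->
    (\int[lam]_x (k x)%:E = v%:E * \int[lam]_x (k x / v)%:E)%E.
  move=> v0 mk k0; rewrite -ge0_integralZl //; last 3 first.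
  - apply/measurable_EFinP; exact: measurable_funM.
  - by move=> x _; rewrite lee_fin divr_ge0 // ltW.
  - by rewrite lee_fin ltW.
  by apply: eq_integral => x _; rewrite -EFinM mulrC divfK // gt_eqF.
have div01 (k : RT -> R) v : 0 < v -> (forall x, 0 <= k x <= M) ->
    (forall x, k x <= v) -> forall x, 0 <= k x / v <= 1.
  move=> v0 k0M kv x; have /andP[kx _] := k0M x.
  by rewrite divr_ge0 ?(ltW v0) //= ler_pdivrMr // mul1r.
have divr (k : RT -> R) v : (forall x, k x != 0 -> `|x| <= r) ->
    forall x, k x / v != 0 -> `|x| <= r.
  by move=> kr x; rewrite mulf_eq0 negb_or => /andP[/kr].
have divs (k : RT -> R) v : 0 < v -> (forall t, t < v -> exists x, t < k x) ->
    forall t, t < 1 -> exists x, t < k x / v.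
  move=> v0 kv t t1; have [|x tx] := kv (t * v); first by rewrite gtr_pMl.
  by exists x; rewrite ltr_pdivlMr.
have f0 x : 0 <= f x by case/andP: (f0M x).
have g0 x : 0 <= g x by case/andP: (g0M x).
have := @prekopa_leindler_line_normalized (fun x => f x / s) (fun x => g x / u)
  (fun x => h x / c) r.
move=> /(_ (measurable_funM mf (measurable_cst _)) (measurable_funM mg (measurable_cst _))
  (measurable_funM mh (measurable_cst _)) (div01 _ _ s0 f0M fs) (div01 _ _ u0 g0M gu)
  (fun x => divr_ge0 (h0 x) (ltW c0)) (divr _ _ fr) (divr _ _ gr) (divs _ _ s0 sf)
  (divs _ _ u0 ug)) key.
have fin (k : RT -> R) v : 0 < v -> measurable_fun setT k -> (forall x, 0 <= k x <= M) ->
    (forall x, k x != 0 -> `|x| <= r) -> (\int[lam]_x (k x / v)%:E \is a fin_num)%E.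
  move=> v0 mk k0M kr.
  rewrite ge0_fin_numE; last first.
    by apply: int_ge0 => x; rewrite divr_ge0 ?(ltW v0) //; case/andP: (k0M x).
  apply: (@le_lt_trans _ _ (\int[lam]_x ((M / v)%:E * (\1_`[- r, r] x)%:E))%E).
    apply: ge0_le_integral => //.
    - by move=> x _; rewrite lee_fin divr_ge0 ?(ltW v0) //; case/andP: (k0M x).
    - by apply/measurable_EFinP; exact: measurable_funM.
    - by apply: measurable_funeM; apply/measurable_EFinP; exact: measurable_indic.
    - move=> x _; rewrite -EFinM lee_fin indicE mem_setE in_itv /= -ler_norml.
      have [kx|kx] := eqVneq (k x) 0.
        rewrite kx mul0r !mulr_ge0 ?invr_ge0 ?(ltW v0) //.
        by case/andP: (k0M x) => + ; exact: le_trans.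
      rewrite kr // mulr1 ler_pM2r ?invr_gt0 //.
      by case/andP: (k0M x).
  have M0 : 0 <= M by case/andP: (f0M 0) => +; exact: le_trans.
  rewrite ge0_integralZl //; last 2 first.
  - by apply/measurable_EFinP; exact: measurable_indic.
  - by rewrite lee_fin divr_ge0 // ltW.
  rewrite integral_indic // setIT.
  apply: lte_mul_pinfty; rewrite ?lee_fin ?divr_ge0 ?(ltW v0) //.
  suff : (lam `[(- r)%R, r]%classic < +oo)%E by [].
  by rewrite lebesgue_measure_itv /=; case: ifPn => _; rewrite -?EFinD ltry.
rewrite (scale f s) // (scale g u) // (scale h c) //.
have fI := fin f s s0 mf f0M fr; have gJ := fin g u u0 mg g0M gr.
rewrite -(fineK fI) -(fineK gJ) in key *.
set I := fine _ in key *; set J := fine _ in key *.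
have I0 : 0 <= I by apply: fine_ge0; apply: int_ge0 => x; rewrite divr_ge0 // ltW.
have J0 : 0 <= J by apply: fine_ge0; apply: int_ge0 => x; rewrite divr_ge0 // ltW.
rewrite -!EFinM /= !powRM ?(ltW s0) ?(ltW u0) //.
rewrite (_ : _ * _ = c * (I `^ p * J `^ q)); last by rewrite /c; ring.
rewrite EFinM; apply: lee_wpmul2l; first by rewrite lee_fin ltW.
apply: (le_trans _ (key _)).
  by rewrite -!EFinM -EFinD lee_fin powR_weighted_AMGM.
move=> x y.
rewrite !powRM ?invr_ge0 ?(ltW s0) ?(ltW u0) //. rewrite mulrACA ler_pdivlMr //.
apply: le_trans (fgh x y); rewrite le_eqVlt; apply/orP; left; apply/eqP.
have cE : s^-1 `^ p * u^-1 `^ q * c = 1.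
  rewrite /c mulrACA -!powRM ?invr_ge0 ?(ltW s0) ?(ltW u0) //.
  by rewrite !mulVf ?gt_eqF // !powR1 mulr1.
by rewrite -[LHS]mulrA cE mulr1.
Qed.

End line.

(** * Lebesgue measure on rows *)

Section lebesgue_rV.
Context (R : realType).
Notation RT := (measurableTypeR R).
Notation lam := (@lebesgue_measure R).
Notation leb := (@lebesgue_rV R _).

Definition row_of_tuple m (s : m.-tuple RT) : 'rV[R]_m := \row_i tnth s i.

Definition tuple_of_row m (v : 'rV[R]_m) : m.-tuple RT := [tuple v 0 i | i < m].

Lemma tuple_of_rowK m : cancel (@tuple_of_row m) (@row_of_tuple m).
Proof. by move=> v; apply/rowP => i; rewrite mxE tnth_mktuple. Qed.

(** Lebesgue measure lives on tuples, linear algebra on rows; measurability of a set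
    of rows is read through the coordinates. *)
Definition measurable_rV m (P : set 'rV[R]_m) :=
  measurable [set s : m.-tuple RT | P (row_of_tuple s)].

Definition cube m (r : R) : set 'rV[R]_m := [set v | forall i, `|v 0 i| <= r].

Definition row_cons m (x : R) (v : 'rV[R]_m) : 'rV[R]_m.+1 := row_mx x%:M v.

Lemma row_consEl m (x : R) (v : 'rV[R]_m) (j : 'I_1) :
  row_cons x v 0 (lshift m j) = x.
Proof. by rewrite [LHS](row_mxEl x%:M v) ord1 mxE eqxx mulr1n. Qed.

Lemma row_consEr m (x : R) (v : 'rV[R]_m) (j : 'I_m) :
  row_cons x v 0 (rshift 1 j) = v 0 j.
Proof. by rewrite [LHS](row_mxEr x%:M v). Qed.

Lemma row_of_consp m (s : m.-tuple RT) (x : R) :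
  row_of_tuple (consp (s, x)) = row_cons x (row_of_tuple s).
Proof.
apply/rowP => i; rewrite mxE; case: (split_ordP (i : 'I_(1 + m))) => j ->.
  by rewrite row_consEl (tnth_nth 0) ord1.
by rewrite row_consEr mxE (tnth_nth 0) [RHS](tnth_nth 0).
Qed.

Lemma measurable_row_of_tuple m d (T : measurableType d) (f : T -> m.-tuple RT) i :
  measurable_fun setT f -> measurable_fun setT (fun t => row_of_tuple (f t) 0 i : RT).
Proof.
move=> /measurable_fun_tnthP /(_ i) mf.
by apply: eq_measurable_fun mf => t _; rewrite mxE.
Qed.

Lemma measurable_coord m (i : 'I_m) :
  measurable_fun setT (fun s : m.-tuple RT => row_of_tuple s 0 i : RT).
Proof. exact: (measurable_row_of_tuple i (@measurable_id _ _ _)). Qed.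

(** As for any product sigma-algebra, measurability of a map into rows is tested on
    coordinates. *)
Lemma measurable_rV_preimage m d (T : measurableType d) (F : T -> 'rV[R]_m)
    (P : set 'rV[R]_m) :
  (forall i, measurable_fun setT (fun t => F t 0 i : RT)) -> measurable_rV P ->
  measurable [set t | P (F t)].
Proof.
move=> mF mP.
have mG : measurable_fun setT (fun t => tuple_of_row (F t)).
  apply/measurable_fun_tnthP => i.
  by apply: eq_measurable_fun (mF i) => t _; rewrite /= tnth_mktuple.
have := mG measurableT _ mP; rewrite setTI.
by congr measurable; apply/seteqP; split => t /=; rewrite tuple_of_rowK.
Qed.

Lemma measurable_forall d (T : measurableType d) (I : finType) (P : I -> set T) :
  (forall i, measurable (P i)) -> measurable [set t | forall i, P i t].
Proof.
move=> mP; rewrite (_ : [set t | _] = \bigcap_(i in [set: I]) P i).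
  by apply: fin_bigcap_measurable.
by apply/seteqP; split => t Pt i; [move=> _|]; exact: Pt.
Qed.

Lemma lebesgue_tupleS m (A : set (m.+1.-tuple RT)) :
  lebesgue_tuple R m.+1 A = (lebesgue_tuple R m \x lam)%E (@consp R m @^-1` A).
Proof. by []. Qed.

Lemma lebesgue_rV_cube m (r : R) : 0 <= r ->
  measurable_rV (@cube m r) /\ leb (@cube m r) = ((2 * r) ^+ m)%:E.
Proof.
move=> r0; elim: m => [|m [mQ IH]].
  split; first by rewrite /measurable_rV [X in measurable X](_ : _ = setT) //;
    apply/seteqP; split => // s _ [].
  rewrite /lebesgue_rV /= diracE mem_set //=.
  by case.
have lamI : lam `[-r, r]%classic = (2 * r)%:E.
  rewrite lebesgue_measure_itv /= lte_fin; case: ltP => rr.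
    by rewrite -EFinD; congr (_%:E); lra.
  by congr (_%:E); lra.
have mI : measurable (`[-r, r]%classic : set RT) by exact: measurable_itv.
have QX : @consp R m @^-1` [set s | cube r (row_of_tuple s)] =
    [set s | cube r (row_of_tuple s)] `*` `[-r, r]%classic.
  apply/seteqP; split => -[s x]; rewrite /= in_itv /= -ler_norml.
    move=> H; split.
      by move=> i; have := H (lift ord0 i); rewrite !mxE !(tnth_nth 0).
    by have := H ord0; rewrite mxE (tnth_nth 0).
  move=> [H1 H2] i; case: (unliftP ord0 i) => [j ->|->]; rewrite mxE (tnth_nth 0) //=.
  by have := H1 j; rewrite mxE (tnth_nth 0).
split.
  apply: measurable_forall => i.
  rewrite -[X in measurable X]setTI.
  apply: (measurable_fun_ler (f := fun s : m.+1.-tuple RT => `|row_of_tuple s 0 i|)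
    _ (measurable_cst r) measurableT (Y := [set true])) => //.
  apply: (measurableT_comp (@normr_measurable _ _)).
  exact: measurable_coord.
rewrite /lebesgue_rV lebesgue_tupleS.
rewrite [X in (_ \x _)%E X]QX product_measure1E // [X in (X * _)%E]IH.
by rewrite [X in (_ * X)%E]lamI -EFinM exprSr.
Qed.

Lemma cube_exhaustive m (v : 'rV[R]_m) : exists k : nat, cube k%:R v.
Proof.
exists (\sum_i Num.bound (`|v 0 i|)%R)%N => i.
apply: le_trans (ltW (archi_boundP (normr_ge0 _))) _.
by rewrite ler_nat (bigD1 i) //= leq_addr.
Qed.

Lemma lebesgue_tuple_sigma_finite m : sigma_finite setT (lebesgue_tuple R m).
Proof.
exists (fun k => [set s | cube k%:R (row_of_tuple s)]).
  by apply/seteqP; split => // s _; have [k sk] := cube_exhaustive (row_of_tuple s); exists k.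
move=> k; have [mC lC] := @lebesgue_rV_cube m k%:R (ler0n _ _).
by split => //; rewrite [X in (X < _)%E]lC ltry.
Qed.

(** A copy of Lebesgue measure that carries the sigma-finite structure which
    Tonelli's theorem asks for. *)
Definition lebn m : set (m.-tuple RT) -> \bar R := lebesgue_tuple R m.

HB.instance Definition _ m := isMeasure.Build _ _ _ (@lebn m)
  (measure0 (lebesgue_tuple R m)) (measure_ge0 (lebesgue_tuple R m))
  (@measure_semi_sigma_additive _ _ _ (lebesgue_tuple R m)).

HB.instance Definition _ m := Measure_isSigmaFinite.Build _ _ _ (@lebn m)
  (lebesgue_tuple_sigma_finite m).

Lemma lebesgue_rVE m (P : set 'rV[R]_m) :
  leb P = lebn [set s | P (row_of_tuple s)].
Proof. by []. Qed.

Lemma measurable_row_cons m d (T : measurableType d) (f : T -> RT)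
    (F : T -> 'rV[R]_m) :
  measurable_fun setT f ->
  (forall i, measurable_fun setT (fun t => F t 0 i : RT)) ->
  forall i, measurable_fun setT (fun t => row_cons (f t) (F t) 0 i : RT).
Proof.
move=> mf mF i; case: (split_ordP (i : 'I_(1 + m))) => j ->.
  by apply: eq_measurable_fun mf => t _; rewrite row_consEl.
by apply: eq_measurable_fun (mF j) => t _; rewrite row_consEr.
Qed.

Lemma measurable_rV_slice m (P : set 'rV[R]_m.+1) (x : R) : measurable_rV P ->
  measurable_rV [set v | P (row_cons x v)].
Proof.
move=> mP; apply: (measurable_rV_preimage (F := fun s => row_cons x (row_of_tuple s))) => //.
apply: measurable_row_cons => // i.
exact: measurable_coord.
Qed.

Lemma measurable_rV_cons m (P : set 'rV[R]_m.+1) : measurable_rV P ->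
  measurable [set p : m.-tuple RT * RT | P (row_cons p.2 (row_of_tuple p.1))].
Proof.
move=> mP; apply: measurable_rV_preimage mP.
by apply: measurable_row_cons => // i; exact: measurable_row_of_tuple.
Qed.

(** Cavalieri's principle along the first coordinate; every induction on the
    dimension goes through it. *)
Lemma lebesgue_rVS m (P : set 'rV[R]_m.+1) : measurable_rV P ->
  (leb P = \int[lam]_x leb [set v | P (row_cons x v)])%E.
Proof.
move=> mP; have mS := measurable_rV_cons mP.
transitivity ((@lebn m \x lam) [set p | P (row_cons p.2 (row_of_tuple p.1))])%E.
  rewrite /lebesgue_rV lebesgue_tupleS; congr ((_ \x _)%E _).
  by apply/seteqP; split => -[s x] /=; rewrite -row_of_consp.
exact: (product_measure_swap (@lebn m) lam mS).
Qed.

Lemma measurable_lebesgue_slice m (P : set 'rV[R]_m.+1) : measurable_rV P ->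
  measurable_fun setT (fun x : RT => leb [set v | P (row_cons x v)]).
Proof.
move=> /measurable_rV_cons mS.
have := measurable_fun_ysection (@lebn m) mS.
by apply: eq_measurable_fun => x _ /=; rewrite ysectionE.
Qed.

Lemma le_lebesgue_rV m (P Q : set 'rV[R]_m) : measurable_rV P -> measurable_rV Q ->
  P `<=` Q -> (leb P <= leb Q)%E.
Proof.
move=> mP mQ PQ; rewrite !lebesgue_rVE; apply: le_measure; rewrite ?inE //.
by move=> s /=; exact: PQ.
Qed.

Lemma lebesgue_rV_translate m (c : 'rV[R]_m) (P : set 'rV[R]_m) :
  measurable_rV P -> leb [set v | P (v + c)] = leb P.
Proof.
elim: m => [|m IH] in c P *; first by move=> _; congr (leb _); apply/seteqP; split => v /=;
  rewrite [v + c]thinmx0 [v]thinmx0.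
move=> mP.
have mPc : measurable_rV [set v | P (v + c)].
  apply: (measurable_rV_preimage (F := fun s => row_of_tuple s + c)) => // i.
  have H : measurable_fun setT (fun s : m.+1.-tuple RT => row_of_tuple s 0 i + c 0 i : RT).
    by apply: measurable_funD => //; exact: measurable_coord.
  by apply: eq_measurable_fun H => s _; rewrite [RHS]mxE.
rewrite !lebesgue_rVS //.
set c0 := (c : 'M[R]_(1, 1 + m)).
have cE : c = row_cons (lsubmx c0 0 0) (rsubmx c0).
  by rewrite -[LHS](hsubmxK c0) /row_cons -mx11_scalar.
have addE x v : row_cons x v + c = row_cons (1 * x + lsubmx c0 0 0) (v + rsubmx c0).
  by rewrite mul1r {1}cE [LHS](add_row_mx x%:M v) /row_cons raddfD.
rewrite [RHS](integral_affine (c := 1) (lsubmx c0 0 0)) ?oner_eq0 //; last first.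
  exact: measurable_lebesgue_slice.
rewrite normr1 mul1e; apply: eq_integral => x _.
rewrite -[RHS](IH (rsubmx c0)); last exact: measurable_rV_slice.
by congr (leb _); apply/seteqP; split => v; rewrite /= addE.
Qed.

Lemma lebesgue_rV_opp m (P : set 'rV[R]_m) :
  measurable_rV P -> leb [set v | P (- v)] = leb P.
Proof.
elim: m => [|m IH] in P *; first by move=> _; congr (leb _); apply/seteqP; split => v /=;
  rewrite [- v]thinmx0 [v]thinmx0.
move=> mP.
have mPc : measurable_rV [set v | P (- v)].
  apply: (measurable_rV_preimage (F := fun s => - row_of_tuple s)) => // i.
  have H : measurable_fun setT (fun s : m.+1.-tuple RT => - row_of_tuple s 0 i : RT).
    by apply: measurable_funN => //; exact: measurable_coord.
  by apply: eq_measurable_fun H => s _; rewrite [RHS]mxE.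
rewrite !lebesgue_rVS //.
have oppE x v : - row_cons x v = row_cons ((-1) * x + 0) (- v) :> 'rV[R]_m.+1.
  by rewrite mulN1r addr0 [LHS](opp_row_mx x%:M v) /row_cons raddfN.
rewrite [RHS](integral_affine (c := (-1)%R) 0) ?oppr_eq0 ?oner_eq0 //; last first.
  exact: measurable_lebesgue_slice.
rewrite normrN1 mul1e; apply: eq_integral => x _.
rewrite -[RHS]IH; last exact: measurable_rV_slice.
by congr (leb _); apply/seteqP; split => v; rewrite /= oppE.
Qed.

End lebesgue_rV.

(** * Brunn-Minkowski inequality and orthogonal invariance *)

Section geometry.
Context (R : realType).
Notation RT := (measurableTypeR R).
Notation lam := (@lebesgue_measure R).
Notation leb := (@lebesgue_rV R _).

Lemma lebesgue_rV0 m : leb (set0 : set 'rV[R]_m) = 0%E.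
Proof. exact: (measure0 (lebn (R := R) (m := m))). Qed.

Lemma lebesgue_rV_ge0 m (P : set 'rV[R]_m) : (0 <= leb P)%E.
Proof. exact: (measure_ge0 (lebn (R := R) (m := m))). Qed.

Lemma lebesgue_rV_dim0 (P : set 'rV[R]_0) : leb P = ((0 : 'rV[R]_0) \in P)%:R%:E.
Proof.
transitivity (\d_([tuple] : 0.-tuple RT) [set s | P (row_of_tuple s)] : \bar R) => //.
rewrite diracE; congr (_%:R%:E); congr nat_of_bool.
by apply/idP/idP; rewrite !inE /= [row_of_tuple _]thinmx0.
Qed.

Section brunn_minkowski.
Variables (p q : R).
Hypotheses (p0 : 0 < p) (q0 : 0 < q) (pq : p + q = 1).

Lemma lebesgue_rV_sub_cube m (A : set 'rV[R]_m) (r : R) : 0 <= r ->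
  measurable_rV A -> A `<=` cube r -> (leb A <= ((2 * r) ^+ m)%:E)%E.
Proof.
move=> r0 mA Ar; have [mQ <-] := lebesgue_rV_cube m r0.
exact: le_lebesgue_rV.
Qed.

Lemma lebesgue_rV_fin m (A : set 'rV[R]_m) (r : R) : 0 <= r ->
  measurable_rV A -> A `<=` cube r -> leb A \is a fin_num.
Proof.
move=> r0 mA Ar; rewrite ge0_fin_numE ?lebesgue_rV_ge0 //.
by apply: le_lt_trans (lebesgue_rV_sub_cube r0 mA Ar) _; rewrite ltry.
Qed.

Lemma cube_slice m (A : set 'rV[R]_m.+1) (r x : R) : A `<=` cube r ->
  [set v | A (row_cons x v)] `<=` cube r.
Proof.
by move=> Ar v /Ar Av i; have := Av (rshift 1 i); rewrite row_consEr.
Qed.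

Lemma cube_slice_head m (A : set 'rV[R]_m.+1) (r x : R) : A `<=` cube r ->
  [set v | A (row_cons x v)] !=set0 -> `|x| <= r.
Proof.
by move=> Ar [v /Ar Av]; have := Av (lshift m (0 : 'I_1)); rewrite row_consEl.
Qed.

Lemma row_cons_conv m (a b x y : R) (v w : 'rV[R]_m) :
  a *: row_cons x v + b *: row_cons y w = row_cons (a * x + b * y) (a *: v + b *: w).
Proof.
have lin (X Y : 'rV[R]_m.+1) i : (a *: X + b *: Y) 0 i = a * X 0 i + b * Y 0 i.
  by rewrite !mxE.
apply/rowP => i; rewrite lin.
have [j ->|j ->] := split_ordP (i : 'I_(1 + m)).
  by rewrite !row_consEl.
by rewrite !row_consEr !mxE.
Qed.

(** Multiplicative form, which survives slicing: by induction the volumes of the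
    slices of A at x, B at y and C at p x + q y satisfy the hypothesis of the
    Prekopa-Leindler inequality in the variable x. Inclusion in a cube makes
    every volume finite, so that [fine] loses nothing. *)
Lemma brunn_minkowski m (A B C : set 'rV[R]_m) (r : R) : 0 <= r ->
  measurable_rV A -> measurable_rV B -> measurable_rV C ->
  A `<=` cube r -> B `<=` cube r -> C `<=` cube r ->
  (forall v w, A v -> B w -> C (p *: v + q *: w)) ->
  fine (leb A) `^ p * fine (leb B) `^ q <= fine (leb C).
Proof.
move=> r0; elim: m => [|m IH] in A B C *.
  move=> mA mB mC _ _ _ ABC; rewrite !lebesgue_rV_dim0 /=.
  have [A0|A0] := boolP (_ \in A); last by rewrite powR0 ?gt_eqF // mul0r.
  have [B0|B0] := boolP (_ \in B); last by rewrite powR0 ?(gt_eqF q0) // mulr0.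
  move: A0 B0; rewrite !inE /= => A0 B0; rewrite !powR1 mulr1.
  by rewrite mem_set //; have := ABC _ _ A0 B0; rewrite [X in C X]thinmx0.
move=> mA mB mC Ar Br Cr ABC.
pose sl (P : set 'rV[R]_m.+1) (x : RT) := fine (leb [set v | P (row_cons x v)]).
have slfin (P : set 'rV[R]_m.+1) x : measurable_rV P -> P `<=` cube r ->
    leb [set v | P (row_cons x v)] \is a fin_num.
  by move=> mP Pr; apply: (lebesgue_rV_fin r0); [exact: measurable_rV_slice | exact: cube_slice].
have sl0 (P : set 'rV[R]_m.+1) x : 0 <= sl P x by rewrite fine_ge0 ?lebesgue_rV_ge0.
have slM (P : set 'rV[R]_m.+1) : measurable_rV P -> P `<=` cube r ->
    forall x, 0 <= sl P x <= (2 * r) ^+ m.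
  move=> mP Pr x; rewrite sl0 /= -lee_fin fineK ?slfin //.
  by apply: lebesgue_rV_sub_cube => //; [exact: measurable_rV_slice | exact: cube_slice].
have slr (P : set 'rV[R]_m.+1) : P `<=` cube r -> forall x, sl P x != 0 -> `|x| <= r.
  move=> Pr x; rewrite /sl; have [P0|/nonemptyPn->] := pselect ([set v | P (row_cons x v)] !=set0).
    by move=> _; exact: cube_slice_head P0.
  by rewrite lebesgue_rV0 eqxx.
have slm (P : set 'rV[R]_m.+1) : measurable_rV P -> measurable_fun setT (sl P).
  by move=> mP; apply: measurableT_comp => //; exact: measurable_lebesgue_slice.
have slI (P : set 'rV[R]_m.+1) : measurable_rV P -> P `<=` cube r ->
    (leb P = \int[lam]_x (sl P x)%:E)%E.
  move=> mP Pr; rewrite lebesgue_rVS //; apply: eq_integral => x _.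
  by rewrite fineK ?slfin.
have /= := prekopa_leindler_line p0 q0 pq (slm _ mA) (slm _ mB) (slm _ mC)
  (slM _ mA Ar) (slM _ mB Br) (sl0 C) (slr _ Ar) (slr _ Br).
rewrite -!slI // -[leb C]fineK ?(lebesgue_rV_fin r0) // lee_fin; apply => x y.
apply: IH; try exact: measurable_rV_slice; try exact: cube_slice.
by move=> v w /= Av Bw; rewrite -row_cons_conv; exact: ABC.
Qed.

Lemma brunn_minkowski_eq m (A B C : set 'rV[R]_m) (r : R) : 0 <= r ->
  measurable_rV A -> measurable_rV B -> measurable_rV C ->
  A `<=` cube r -> B `<=` cube r -> C `<=` cube r ->
  (forall v w, A v -> B w -> C (p *: v + q *: w)) ->
  leb A = leb B -> (leb A <= leb C)%E.
Proof.
move=> r0 mA mB mC Ar Br Cr ABC AB.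
have := brunn_minkowski r0 mA mB mC Ar Br Cr ABC.
rewrite -AB; set a := fine _.
have a0 : 0 <= a by rewrite fine_ge0 ?lebesgue_rV_ge0.
have -> : a `^ p * a `^ q = a.
  have [->|an0] := eqVneq a 0; first by rewrite powR0 ?gt_eqF // mul0r.
  by rewrite -powRD ?pq ?powRr1 // an0 implybT.
by rewrite -lee_fin !fineK ?(lebesgue_rV_fin r0).
Qed.

End brunn_minkowski.

Lemma measurable_coord_mulmx m k d (T : measurableType d) (F : T -> 'rV[R]_m)
    (Q : 'M[R]_(m, k)) :
  (forall i, measurable_fun setT (fun t => F t 0 i : RT)) ->
  forall i, measurable_fun setT (fun t => (F t *m Q) 0 i : RT).
Proof.
move=> mF i.
have H : measurable_fun setT (fun t => \sum_j F t 0 j * Q j i : RT).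
  by apply: measurable_sum => j; apply: measurable_funM => //; exact: mF.
by apply: eq_measurable_fun H => t _; rewrite mxE.
Qed.

Lemma measurable_coordD m d (T : measurableType d) (F G : T -> 'rV[R]_m) :
  (forall i, measurable_fun setT (fun t => F t 0 i : RT)) ->
  (forall i, measurable_fun setT (fun t => G t 0 i : RT)) ->
  forall i, measurable_fun setT (fun t => (F t + G t) 0 i : RT).
Proof.
move=> mF mG i.
have H : measurable_fun setT (fun t => F t 0 i + G t 0 i : RT).
  by apply: measurable_funD; [exact: mF | exact: mG].
by apply: eq_measurable_fun H => t _; rewrite [RHS]mxE.
Qed.

Lemma integral_lebn_fiber m (c : \bar R) (E : set (m.-tuple RT))
    (F : m.-tuple RT -> set (m.-tuple RT)) : (0 <= c)%E -> measurable E ->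
  (forall s, lebn (F s) = c) ->
  (\int[@lebn R m]_s lebn [set t | E s /\ F s t] = c * lebn E)%E.
Proof.
move=> c0 mE Fc.
transitivity (\int[@lebn R m]_s (c * (\1_E s)%:E))%E.
  apply: eq_integral => s _; rewrite indicE; have [sE|sE] := boolP (s \in E).
    rewrite mule1 -(Fc s); congr (lebn _); apply/seteqP; split => t /=; first by case.
    by split => //; rewrite inE in sE.
  rewrite mule0 (_ : [set t | _] = set0) ?measure0 //.
  by apply/seteqP; split => // t [Es _]; rewrite notin_setE in sE.
rewrite ge0_integralZl //.
  by rewrite integral_indic // setIT.
by apply/measurable_EFinP; exact: measurable_indic.
Qed.

Lemma dotC m (x y : 'rV[R]_m) : dot x y = dot y x.
Proof. by apply: eq_bigr => i _; rewrite mulrC. Qed.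

Lemma dotE m (x y : 'rV[R]_m) : dot x y = (x *m y^T) 0 0.
Proof. by rewrite mxE; apply: eq_bigr => i _; rewrite mxE. Qed.

(** The set B is the Euclidean unit ball; it calibrates the constant in the proof of
    orthogonal invariance. *)
Lemma ball_measure m : exists B : set 'rV[R]_m,
  [/\ measurable_rV B, leb B \is a fin_num, leb B != 0%E &
   forall Q : 'M[R]_m, Q *m Q^T = 1%:M -> forall v, B (v *m Q) <-> B v].
Proof.
pose B := [set v : 'rV[R]_m | dot v v <= 1].
have mB : measurable_rV B.
  have H : measurable_fun setT
      (fun s : m.-tuple RT => dot (row_of_tuple s) (row_of_tuple s) : RT).
    by apply: measurable_sum => i; apply: measurable_funM; exact: measurable_coord.
  rewrite /measurable_rV -[X in measurable X]setTI.
  exact: (measurable_fun_ler H (measurable_cst (1 : R)) measurableT (Y := [set true])).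
have B1 : B `<=` cube 1.
  move=> v; rewrite /B /= => v1 i; rewrite -(@expr_le1 _ 2) // real_normK ?num_real //.
  apply: le_trans v1; rewrite /dot (bigD1 i) //= expr2 lerDl sumr_ge0 // => j _.
  by rewrite -expr2 sqr_ge0.
exists B; split => //.
- exact: (lebesgue_rV_fin ler01).
- pose r : R := m.+1%:R^-1.
  have r0 : 0 < r by rewrite invr_gt0.
  have [mQ lQ] := lebesgue_rV_cube m (ltW r0).
  rewrite gt_eqF //; apply: (@lt_le_trans _ _ (leb (cube (m := m) r))).
    by rewrite lQ lte_fin exprn_gt0 // mulr_gt0.
  apply: le_lebesgue_rV => // v vr.
  apply: (@le_trans _ _ (\sum_(i < m) r)).
    apply: ler_sum => i _; apply: (@le_trans _ _ (r * r)).
      rewrite -expr2 -real_normK ?num_real // expr2.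
      by apply: ler_pM.
    by rewrite ler_piMr ?(ltW r0) // invf_le1 // ler1n.
  by rewrite sumr_const card_ord -mulr_natl ler_pdivrMr // mul1r ler_nat.
- move=> Q QQ v; rewrite /B /= !dotE trmx_mul mulmxA -(mulmxA v) QQ mulmx1.
  by split.
Qed.

(** Uniqueness of the translation invariant measure, in Fubini form. For fixed x the
    integral over y of 1_A (x Q) 1_B (y + x Q) is 1_A (x Q) vol(B), so the double
    integral is vol(B) vol(A Q^T). For fixed y, translating x by - y Q^T turns the
    integrand into 1_A (- y + x Q) 1_B (x Q), whose double integral is
    vol(A) vol(B Q^T) by translation and reflection in y. When B is a ball,
    B Q^T = B has finite nonzero volume and can be cancelled. *)
Lemma lebesgue_rV_orth m (Q : 'M[R]_m) (A : set 'rV[R]_m) : Q *m Q^T = 1%:M ->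
  measurable_rV A -> leb [set v | A (v *m Q)] = leb A.
Proof.
move=> QQ mA; have [B [mB Bfin B0 BQ]] := ball_measure m.
have QtQ : Q^T *m Q = 1%:M by apply: mulmx1C.
have mrow (i : 'I_m) (f : (m.-tuple RT * m.-tuple RT) -> m.-tuple RT) :
    measurable_fun setT f -> measurable_fun setT (fun p => row_of_tuple (f p) 0 i : RT).
  exact: measurable_row_of_tuple.
have mAQ : measurable [set s : m.-tuple RT | A (row_of_tuple s *m Q)].
  by apply: measurable_rV_preimage mA => i; apply: measurable_coord_mulmx => j;
    exact: measurable_coord.
have mBQ : measurable [set s : m.-tuple RT | B (row_of_tuple s *m Q)].
  by apply: measurable_rV_preimage mB => i; apply: measurable_coord_mulmx => j;
    exact: measurable_coord.
pose S := [set p : m.-tuple RT * m.-tuple RT |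
  A (row_of_tuple p.1 *m Q) /\ B (row_of_tuple p.2 + row_of_tuple p.1 *m Q)].
pose S' := [set p : m.-tuple RT * m.-tuple RT |
  B (row_of_tuple p.1 *m Q) /\ A (- row_of_tuple p.2 + row_of_tuple p.1 *m Q)].
have mS : measurable S.
  apply: measurableI.
  - by apply: measurable_rV_preimage mA; apply: measurable_coord_mulmx => i; exact: mrow.
  - apply: measurable_rV_preimage mB; apply: measurable_coordD => i; first exact: mrow.
    by apply: measurable_coord_mulmx => j; exact: mrow.
have mS' : measurable S'.
  apply: measurableI.
  - by apply: measurable_rV_preimage mB; apply: measurable_coord_mulmx => i; exact: mrow.
  - apply: measurable_rV_preimage mA; apply: measurable_coordD => i; last first.
      by apply: measurable_coord_mulmx => j; exact: mrow.
    have H : measurable_fun setT (fun p : m.-tuple RT * m.-tuple RT =>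
        - row_of_tuple p.2 0 i : RT) by apply: measurable_funN => //; exact: mrow.
    by apply: eq_measurable_fun H => t _; rewrite [RHS]mxE.
have H1 := integral_lebn_fiber (lebesgue_rV_ge0 B) mAQ
  (fun s => lebesgue_rV_translate (row_of_tuple s *m Q) mB).
have H2 : (\int[@lebn R m]_s lebn [set t : m.-tuple RT | B (row_of_tuple s *m Q) /\
      A (- row_of_tuple t + row_of_tuple s *m Q)%R] =
    leb A * lebn [set s : m.-tuple RT | B (row_of_tuple s *m Q)])%E.
  apply: (integral_lebn_fiber (lebesgue_rV_ge0 A) mBQ) => s.
  have mT : measurable_rV [set v | A (v + row_of_tuple s *m Q)].
    apply: (measurable_rV_preimage (F := fun t => row_of_tuple t + row_of_tuple s *m Q)) => //.
    by apply: measurable_coordD => i //; exact: measurable_coord.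
  by rewrite -(lebesgue_rV_translate (row_of_tuple s *m Q) mA) -(lebesgue_rV_opp mT).
have T1 := tonelli_set (@lebn R m) (@lebn R m) mS.
have T2 := tonelli_set (@lebn R m) (@lebn R m) mS'.
have BQE : [set s : m.-tuple RT | B (row_of_tuple s *m Q)] = [set s | B (row_of_tuple s)].
  by apply/seteqP; split => s /=; rewrite BQ.
have SS' y : lebn [set s | S (s, y)] = lebn [set s | S' (s, y)].
  pose P := [set v | B (v *m Q) /\ A (- row_of_tuple y + v *m Q)].
  have mP : measurable_rV P.
    apply: measurableI => //; apply: measurable_rV_preimage mA.
    apply: measurable_coordD => i //; apply: measurable_coord_mulmx => j.
    exact: measurable_coord.
  transitivity (leb [set v | P (v + row_of_tuple y *m Q^T)]); last first.
    by rewrite lebesgue_rV_translate.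
  congr lebn; apply/seteqP; split => s; rewrite /S /P /= mulmxDl -!mulmxA QtQ mulmx1;
    rewrite [X in - _ + X]addrC addKr [row_of_tuple s *m Q + _]addrC; by case.
have E : (leb B * leb [set v | A (v *m Q)] = leb A * leb B)%E.
  rewrite [X in (leb A * X)%E](_ : _ = lebn [set s : m.-tuple RT | B (row_of_tuple s *m Q)]);
    last by rewrite BQE.
  rewrite -H2 -[LHS]H1 [LHS]T1 [RHS]T2.
  by apply: eq_integral => y _; exact: SS'.
have b0 : fine (leb B) != 0 by rewrite fine_eq0.
have bK (X : \bar R) : X = ((fine (leb B))^-1%:E * (leb B * X))%E.
  by rewrite -{2}(fineK Bfin) muleA -EFinM mulVf // mul1e.
by rewrite [LHS]bK E [X in (_ * X)%E]muleC -bK.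
Qed.

End geometry.

(** * Hyperplane sections in an orthonormal frame *)

Section sections.
Context (R : realType).
Notation RT := (measurableTypeR R).
Notation lam := (@lebesgue_measure R).
Notation leb := (@lebesgue_rV R _).

(** An open set is the union of the boxes with rational centre and radius 1/(k+1)
    that it contains, and there are countably many of them. *)
Lemma open_measurable_rV m (U : set 'rV[R]_m) : open U -> measurable_rV U.
Proof.
move=> oU.
pose box (qk : 'rV[rat]_m * nat) : set 'rV[R]_m :=
  [set v | forall i, `|v 0 i - ratr (qk.1 0 i)| < qk.2.+1%:R^-1].
pose F qk : set (m.-tuple RT) :=
  if pselect (box qk `<=` U) then [set s | box qk (row_of_tuple s)] else set0.
have mbox qk : measurable [set s : m.-tuple RT | box qk (row_of_tuple s)].
  apply: measurable_forall => i.
  have H : measurable_fun setT (fun s : m.-tuple RT =>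
      `|row_of_tuple s 0 i - ratr (qk.1 0 i)| : RT).
    apply: measurableT_comp => //; apply: measurable_funB => //; exact: measurable_coord.
  rewrite -[X in measurable X]setTI.
  exact: (measurable_fun_ltr H (measurable_cst (qk.2.+1%:R^-1 : R)) measurableT
    (Y := [set true])).
rewrite /measurable_rV (_ : [set s | _] = \bigcup_qk F qk).
  apply: countable_bigcupT_measurable => // qk; rewrite /F.
  by case: pselect => ?; [exact: mbox | exact: measurable0].
apply/seteqP; split => s; last first.
  by move=> [qk _]; rewrite /F; case: pselect => // sub /sub.
rewrite /=; set v := row_of_tuple s => Uv.
have /nbhs_ballP[e /= e0 eU] : nbhs v U by exact: open_nbhs_nbhs.
have [k ke] : exists k : nat, k.+1%:R^-1 + k.+1%:R^-1 < e.
  have [k] := ltr_add_invr (divr_gt0 e0 (ltr0n _ 2)).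
  by rewrite add0r => H; exists k; rewrite [ltRHS]splitr ltrD.
have k0 : 0 < k.+1%:R^-1 :> R by rewrite invr_gt0.
set y : R := k.+1%:R^-1 in ke k0.
have rat_ex (x : R) : exists q : rat, `|x - ratr q| < y.
  have xy : x - y < x + y by lra.
  have [q] := rat_in_itvoo xy.
  by rewrite in_itv /= => /andP[? ?]; exists q; rewrite ltr_norml; apply/andP; split; lra.
have [q qv] := choice (fun i => rat_ex (v 0 i)).
exists (\row_i q i, k) => //; rewrite /F; case: pselect => [_ | []] /=.
  by move=> i /=; rewrite !mxE; have := qv i; rewrite mxE.
move=> w wbox; apply: eU; split => // i j; rewrite ord1.
have := qv j; have := wbox j; rewrite /= mxE => h1 h2.
rewrite /ball /=; apply: lt_trans ke.
have -> : v 0 j - w 0 j = (v 0 j - ratr (q j)) - (w 0 j - ratr (q j)) by ring.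
by apply: le_lt_trans (ler_normB _ _) _; rewrite ltrD.
Qed.

Lemma compact_measurable_rV m (K : set 'rV[R]_m) : compact K -> measurable_rV K.
Proof.
move=> /(compact_closed (@norm_hausdorff _ _)) /closed_openC /open_measurable_rV mK.
rewrite /measurable_rV -[X in measurable X]setCK; apply: measurableC; exact: mK.
Qed.

Lemma compact_cube m (K : set 'rV[R]_m) : compact K ->
  exists2 M : R, 0 <= M & K `<=` cube M.
Proof.
move=> /compact_bounded [N [_ HN]].
have N1 : N < `|N| + 1 by rewrite (le_lt_trans (ler_norm _)) // ltrDl.
exists (`|N| + 1); first by rewrite addr_ge0.
move=> v Kv i; have := HN _ N1 v Kv.
apply: le_trans; rewrite [leRHS]mx_normrE.
exact: (le_bigmax _ (fun i : 'I_1 * 'I_m => `|v i.1 i.2|) (0, i)).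
Qed.

Lemma dotZl m (t : R) (x y : 'rV[R]_m) : dot (t *: x) y = t * dot x y.
Proof. by rewrite !dotE -scalemxAl mxE. Qed.

Lemma dotZr m (t : R) (x y : 'rV[R]_m) : dot x (t *: y) = t * dot x y.
Proof. by rewrite dotC dotZl dotC. Qed.

Lemma dotDl m (x y z : 'rV[R]_m) : dot (x + y) z = dot x z + dot y z.
Proof. by rewrite !dotE mulmxDl mxE. Qed.

Lemma dotDr m (x y z : 'rV[R]_m) : dot x (y + z) = dot x y + dot x z.
Proof. by rewrite dotC dotDl !(dotC x). Qed.

Lemma dot_ge0 m (x : 'rV[R]_m) : 0 <= dot x x.
Proof. by apply: sumr_ge0 => i _; rewrite -expr2 sqr_ge0. Qed.

Lemma dot_eq0 m (x : 'rV[R]_m) : (dot x x == 0) = (x == 0).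
Proof.
apply/idP/eqP => [|->]; last first.
  by rewrite /dot big1 // => i _; rewrite mxE mul0r.
rewrite /dot psumr_eq0; last by move=> i _; rewrite -expr2 sqr_ge0.
move=> /allP uz; apply/rowP => i; rewrite mxE.
by have := uz i (mem_index_enum _); rewrite /= mulf_eq0 orbb => /eqP.
Qed.

Lemma sqr_norm2 m (x : 'rV[R]_m) : norm2 x ^+ 2 = dot x x.
Proof. by rewrite sqr_sqrtr ?dot_ge0. Qed.

Lemma norm2_gt0 m (x : 'rV[R]_m) : x != 0 -> 0 < norm2 x.
Proof. by move=> x0; rewrite sqrtr_gt0 lt_def dot_eq0 x0 dot_ge0. Qed.

Lemma dot_normalize m (x : 'rV[R]_m) : x != 0 ->
  dot ((norm2 x)^-1 *: x) ((norm2 x)^-1 *: x) = 1.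
Proof.
move=> /norm2_gt0 x0; rewrite dotZl dotZr -sqr_norm2; field.
by rewrite gt_eqF.
Qed.

(** The rows of U are chosen one at a time: a unit vector is taken in the kernel of
    A^T, nonzero by a rank count, and is appended to A before continuing. *)
Lemma exists_orthonormal r k n (A : 'M[R]_(k, n)) : (r + k <= n)%N ->
  exists U : 'M[R]_(r, n), U *m U^T = 1%:M /\ U *m A^T = 0.
Proof.
elim: r k A => [|r IH] k A rkn.
  by exists 0; split; apply/matrixP => -[].
have kerN0 : kermx A^T != 0.
  rewrite -mxrank_eq0 mxrank_ker -lt0n subn_gt0.
  apply: (leq_ltn_trans (rank_leq_col _)); move: rkn; rewrite addSn.
  by apply: leq_trans; rewrite ltnS leq_addl.
have [u /sub_kermxP uA u0] := rowV0Pn kerN0.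
pose w := (norm2 u)^-1 *: u.
have w1 : w *m w^T = 1%:M.
  by rewrite [LHS]mx11_scalar -dotE dot_normalize.
have [|U [UU UA]] := IH _ (col_mx w A); first by rewrite add1n addnS -addSn.
move: UA; rewrite tr_col_mx mul_mx_row -row_mx0 => /eq_row_mx [Uw UA].
have : exists V : 'M[R]_(1 + r, n), V *m V^T = 1%:M /\ V *m A^T = 0.
  exists (col_mx w U); split.
    rewrite tr_col_mx mul_col_row w1 UU Uw -[w *m U^T]trmxK trmx_mul trmxK Uw trmx0.
    by rewrite -scalar_mx_block.
  by rewrite mul_col_mx UA /w -scalemxAl uA scaler0 col_mx0.
by [].
Qed.

(** The row space of W is contained in the hyperplane orthogonal to a and both have
    dimension n - 1. *)
Lemma frame_span n (W : 'M[R]_(n.-1, n)) (a x : 'rV[R]_n) : a != 0 ->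
  W *m W^T = 1%:M -> W *m a^T = 0 -> dot x a = 0 -> x *m W^T *m W = x.
Proof.
move=> a0 WW Wa xa.
have n0 : (0 < n)%N by case: n a a0 {W x WW Wa xa} => // a; rewrite thinmx0 eqxx.
have rW : \rank W = n.-1.
  apply/eqP; rewrite eqn_leq rank_leq_row /=.
  by rewrite -{1}(mxrank1 R n.-1) -WW mxrankM_maxl.
have rA : \rank (kermx a^T) = n.-1.
  rewrite mxrank_ker mxrank_tr rank_rV a0 subn1 //.
have Wker : (W <= kermx a^T)%MS by apply/sub_kermxP.
have kerW : (kermx a^T <= W)%MS by rewrite -(geq_leqif (mxrank_leqif_sup Wker)) rA rW.
have xker : (x <= kermx a^T)%MS.
  by apply/sub_kermxP; rewrite [LHS]mx11_scalar -dotE xa raddf0.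
have /submxP[c ->] := submx_trans xker kerW.
by rewrite -[c *m W *m W^T]mulmxA WW mulmx1.
Qed.

Lemma hframe_spec n (a : 'rV[R]_n) : (0 < n)%N ->
  hframe a *m (hframe a)^T = 1%:M /\ hframe a *m a^T = 0.
Proof.
move=> n0.
have [U HU] := @exists_orthonormal n.-1 1 n a (eq_leq (eq_trans (addn1 _) (prednK n0))).
have := @xgetPex _ 0 [set U : 'M[R]_(n.-1, n) | U *m U^T = 1%:M /\ U *m a^T = 0].
by apply; exists U.
Qed.

Lemma mem_orth n (a x : 'rV[R]_n) : orth a x <-> x *m a^T = 0.
Proof.
rewrite /orth /=; split=> [xa|xa].
  by rewrite [LHS]mx11_scalar -dotE xa raddf0.
by rewrite dotE xa mxE.
Qed.

Lemma measurable_rV_affine_section k n (K : set 'rV[R]_n) (W : 'M[R]_(k, n)) x0 :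
  measurable_rV K -> measurable_rV [set c | K (x0 + c *m W)].
Proof.
move=> mK; apply: (measurable_rV_preimage (F := fun s => x0 + row_of_tuple s *m W)) => //.
apply: measurable_coordD => // i; apply: measurable_coord_mulmx => j.
exact: measurable_coord.
Qed.

(** Two orthonormal frames H, W of the hyperplane differ by the orthogonal matrix
    H W^T, which preserves Lebesgue measure; so the frame picked in the definition
    of the volume can be replaced with a convenient one. *)
Lemma hyperplane_vol_frame n (K : set 'rV[R]_n) (a : 'rV[R]_n) (t : R)
    (W : 'M[R]_(n.-1, n)) : measurable_rV K -> a != 0 ->
  W *m W^T = 1%:M -> W *m a^T = 0 ->
  hyperplane_vol a (K `&` translate (t *: a) (orth a)) =
    leb [set c | K (t *: a + c *m W)].
Proof.
move=> mK a0 WW Wa.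
have n0 : (0 < n)%N by case: n a a0 {W WW Wa mK K} => // a; rewrite thinmx0 eqxx.
have [HH Ha] := hframe_spec a n0.
set H := hframe a in HH Ha *.
have aH : a *m H^T = 0 by rewrite -[LHS]trmxK trmx_mul trmxK Ha trmx0.
have HWW : H *m W^T *m W = H.
  apply/row_matrixP => i; rewrite !row_mul; apply: (frame_span a0 WW Wa).
  by rewrite dotE -row_mul Ha !mxE.
have spanH x : orth a x -> x *m H^T *m H = x by move=> xa; apply: (frame_span a0).
rewrite /hyperplane_vol -/H.
have -> : [set x *m H^T | x in K `&` translate (t *: a) (orth a)] =
    [set c | K (t *: a + c *m H)].
  apply/seteqP; split => c /=.
    move=> [x [Kx [z az zx]] <-]; rewrite -{x}zx in Kx *.
    by move: Kx; rewrite mulmxDl -scalemxAl aH scaler0 add0r spanH.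
  move=> Kc; exists (t *: a + c *m H).
    by split => //; exists (c *m H) => //; apply/mem_orth; rewrite -mulmxA Ha mulmx0.
  by rewrite mulmxDl -scalemxAl aH scaler0 add0r -mulmxA HH mulmx1.
have QQ : (H *m W^T) *m (H *m W^T)^T = 1%:M.
  by rewrite trmx_mul trmxK mulmxA HWW HH.
rewrite -[RHS](lebesgue_rV_orth QQ (measurable_rV_affine_section W (t *: a) mK)).
by congr (leb _); apply/seteqP; split => c /=; rewrite -mulmxA HWW.
Qed.

Lemma convex_setP n (K : set 'rV[R]_n) (p q : R) x y : convex_set K ->
  0 <= p -> 0 <= q -> p + q = 1 -> K x -> K y -> K (p *: x + q *: y).
Proof.
move=> cK p0 q0 pq Kx Ky.
have p1 : p <= 1 by rewrite -pq lerDl.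
have := cK x y (Itv01 p0 p1) (mem_set Kx) (mem_set Ky).
rewrite inE.
have -> : q = 1 - p by rewrite -pq addrAC subrr add0r.
by [].
Qed.

Lemma section_cube k n (K : set 'rV[R]_n) (W : 'M[R]_(k, n)) x0 : compact K ->
  W *m W^T = 1%:M -> exists2 r : R, 0 <= r & [set c | K (x0 + c *m W)] `<=` cube r.
Proof.
move=> /compact_cube [M M0 KM] WW.
pose b i := \sum_j (M + `|x0 0 j|) * `|W i j|.
have b0 i : 0 <= b i by apply: sumr_ge0 => j _; rewrite mulr_ge0 // addr_ge0.
exists (\sum_i b i); first exact: sumr_ge0.
move=> c /= /KM Kc i; rewrite (bigD1 i) //= ler_wpDr ?sumr_ge0 //.
have -> : c 0 i = \sum_j ((x0 + c *m W) 0 j - x0 0 j) * W i j.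
  have {1}-> : c = (x0 + c *m W - x0) *m W^T.
    by rewrite addrAC subrr add0r -mulmxA WW mulmx1.
  rewrite mxE; apply: eq_bigr => j _.
  have sub (y z : 'rV[R]_n) : (y - z) 0 j = y 0 j - z 0 j by rewrite !mxE.
  by rewrite sub [W^T _ _]mxE.
apply: le_trans (ler_norm_sum _ _ _) _; apply: ler_sum => j _.
rewrite normrM ler_wpM2r //; apply: le_trans (ler_normB _ _) _.
by rewrite lerD2r; exact: Kc.
Qed.

(** Brunn's theorem for parallel sections S u of a body symmetric about x0. With
    weights p, q such that s = p t + q (- t), convexity puts p S t + q S (- t)
    inside S s, and S (- t) = - S t has the same volume as S t, so the
    Brunn-Minkowski inequality compares S t with S s. *)
Lemma brunn_symmetric k n (K : set 'rV[R]_n) (W : 'M[R]_(k, n)) (x0 d : 'rV[R]_n)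
    (s t : R) : compact K -> convex_set K -> W *m W^T = 1%:M ->
  (forall u c, K (x0 + u *: d + c *m W) -> K (x0 - u *: d - c *m W)) ->
  `|s| <= `|t| ->
  (leb [set c | K (x0 + t *: d + c *m W)%R] <=
   leb [set c | K (x0 + s *: d + c *m W)%R])%E.
Proof.
move=> compK convK WW sym.
have mK := compact_measurable_rV compK.
pose S u := [set c | K (x0 + u *: d + c *m W)].
have mS u : measurable_rV (S u) by exact: measurable_rV_affine_section.
have SN u : leb (S (- u)) = leb (S u).
  rewrite -(lebesgue_rV_opp (mS u)); congr (leb _); apply/seteqP; split => c;
    rewrite /S /= => /sym; rewrite ?mulNmx ?scaleNr ?opprK //.
rewrite le_eqVlt => /orP[|st].
  rewrite eqr_norm2 => /orP[/eqP->//|/eqP->].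
  by rewrite -/(S t) -/(S (- t)) SN.
have t0 : 0 < `|t| by apply: le_lt_trans st.
have tn0 : t != 0 by rewrite -normr_gt0.
have : `|s / t| < 1 by rewrite normrM normfV ltr_pdivrMr // mul1r.
rewrite ltr_norml => /andP[h1 h2].
(* Chosen so that p t - q t = s. *)
pose p := (1 + s / t) / 2; pose q := (1 - s / t) / 2.
have p0 : 0 < p by rewrite /p; lra.
have q0 : 0 < q by rewrite /q; lra.
have pq : p + q = 1 by rewrite /p /q; lra.
have [r1 r10 S1] := section_cube (x0 + t *: d) compK WW.
have [r2 r20 S2] := section_cube (x0 + (- t) *: d) compK WW.
have [r3 r30 S3] := section_cube (x0 + s *: d) compK WW.
have cubeS (a b : R) : a <= b -> cube a `<=` cube (m := k) b.
  by move=> ab v va i; exact: le_trans (va i) ab.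
apply: (@brunn_minkowski_eq _ p q p0 q0 pq k (S t) (S (- t)) (S s) (r1 + r2 + r3)) => //.
- by rewrite !addr_ge0.
- apply: subset_trans S1 _; apply: cubeS; lra.
- apply: subset_trans S2 _; apply: cubeS; lra.
- apply: subset_trans S3 _; apply: cubeS; lra.
- move=> v w Sv Sw; have := convex_setP convK (ltW p0) (ltW q0) pq Sv Sw.
  congr K; rewrite !scalerDr addrACA [X in X + _]addrACA -scalerDl pq scale1r.
  rewrite mulmxDl -!scalemxAl; congr (_ + _ + _).
  rewrite !scalerA -scalerDl; congr (_ *: _).
  by rewrite /p /q; field.
Qed.

End sections.

(** * Sections along a reflection *)

Section transfer.
Context (R : realType).
Notation RT := (measurableTypeR R).
Notation lam := (@lebesgue_measure R).
Notation leb := (@lebesgue_rV R _).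

Lemma translate0 n (A : set 'rV[R]_n) : translate 0 A = A.
Proof.
apply/seteqP; split => x /=; first by move=> [z Az <-]; rewrite add0r.
by move=> Ax; exists x; rewrite ?add0r.
Qed.

Lemma central_hyperplane_vol n (K : set 'rV[R]_n) (a : 'rV[R]_n)
    (W : 'M[R]_(n.-1, n)) : measurable_rV K -> a != 0 ->
  W *m W^T = 1%:M -> W *m a^T = 0 ->
  hyperplane_vol a (K `&` orth a) = leb [set c | K (c *m W)].
Proof.
move=> mK a0 WW Wa; have := hyperplane_vol_frame 0 mK a0 WW Wa.
rewrite scale0r translate0 => ->.
by congr (leb _); apply/seteqP; split => c /=; rewrite add0r.
Qed.

(** The hyperplane orthogonal to a = b + kappa e is spanned by the rows of U and by
    w = e - (kappa / |b|^2) b, whose norm is |a| / |b|. Slicing along w and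
    rescaling the variable by |w| produces the Jacobian that turns 1/|a|
    into 1/|b|. *)
Lemma section_volume_slices k (K : set 'rV[R]_k.+2) (e b : 'rV[R]_k.+2)
    (U : 'M[R]_(k, k.+2)) (kappa : R) :
  measurable_rV K -> dot e e = 1 -> dot e b = 0 -> b != 0 ->
  U *m U^T = 1%:M -> U *m e^T = 0 -> U *m b^T = 0 ->
  let a := b + kappa *: e in
  (((norm2 a)^-1)%:E * hyperplane_vol a (K `&` orth a) =
   ((norm2 b)^-1)%:E * \int[lam]_x
     leb [set v | K (x *: e + (- (x * kappa / dot b b)) *: b + v *m U)%R])%E.
Proof.
move=> mK ee eb b0 UU Ue Ub a.
have bb : dot b b != 0 by rewrite dot_eq0.
have bb0 : 0 < dot b b by rewrite lt_def bb dot_ge0.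
have be : dot b e = 0 by rewrite dotC.
have aa : dot a a = dot b b + kappa ^+ 2.
  by rewrite /a !(dotDl, dotDr, dotZl, dotZr) ee eb be; ring.
have aa0 : 0 < dot a a by rewrite aa ltr_pwDl // sqr_ge0.
have a0 : a != 0 by rewrite -dot_eq0 gt_eqF.
pose w := e - (kappa / dot b b) *: b.
have ww : dot w w = dot a a / dot b b.
  by rewrite aa /w -scaleNr !(dotDl, dotDr, dotZl, dotZr) ee eb be; field.
have w0 : w != 0 by rewrite -dot_eq0 ww gt_eqF // divr_gt0.
have wa : dot w a = 0.
  by rewrite /w /a -scaleNr !(dotDl, dotDr, dotZl, dotZr) ee eb be; field; exact: bb.
have normw : norm2 w = norm2 a / norm2 b.
  by rewrite /norm2 ww sqrtrM ?dot_ge0 // sqrtrV ?dot_ge0.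
have na0 := norm2_gt0 a0; have nb0 := norm2_gt0 b0; have nw0 := norm2_gt0 w0.
have dot0 x y : dot x y = 0 -> x *m y^T = 0 :> 'M[R]_1.
  by move=> xy; rewrite [LHS]mx11_scalar -dotE xy raddf0.
have Uw : U *m w^T = 0.
  by rewrite /w linearB /= linearZ /= mulmxBr -scalemxAr Ue Ub scaler0 subrr.
have Ua : U *m a^T = 0.
  by rewrite /a linearD /= linearZ /= mulmxDr -scalemxAr Ue Ub scaler0 addr0.
(* The first row of W is the slicing direction. *)
pose w1 := (norm2 w)^-1 *: w.
have Uw1 : U *m w1^T = 0 by rewrite linearZ /= -scalemxAr Uw scaler0.
pose W : 'M[R]_(1 + k, k.+2) := col_mx w1 U.
have WW : W *m W^T = 1%:M.
  rewrite /W tr_col_mx mul_col_row UU Uw1 -[w1 *m U^T]trmxK trmx_mul trmxK Uw1 trmx0.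
  rewrite [w1 *m w1^T](_ : _ = 1%:M); first by rewrite -scalar_mx_block.
  by rewrite [LHS]mx11_scalar -dotE dot_normalize.
have Wa : W *m a^T = 0.
  by rewrite /W mul_col_mx Ua -scalemxAl dot0 // scaler0 col_mx0.
rewrite (central_hyperplane_vol mK a0 WW Wa).
have mP : measurable_rV [set c : 'rV[R]_k.+1 | K (c *m W)].
  have := measurable_rV_affine_section W 0 mK.
  by congr measurable_rV; apply/seteqP; split => c /=; rewrite add0r.
rewrite (lebesgue_rVS mP).
rewrite (integral_affine (c := norm2 w) 0) ?gt_eqF //; last first.
  exact: (measurable_lebesgue_slice mP).
rewrite muleA -EFinM gtr0_norm //.
have -> : (norm2 a)^-1 * norm2 w = (norm2 b)^-1.
  by rewrite normw mulrA mulVf ?mul1r // gt_eqF.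
congr (_ * _)%E; apply: eq_integral => x _.
have E v : row_cons (norm2 w * x + 0) v *m W =
    x *: e + (- (x * kappa / dot b b)) *: b + v *m U.
  rewrite [LHS](mul_row_col (norm2 w * x + 0)%:M v w1 U) mul_scalar_mx /w1 addr0.
  rewrite scalerA mulrAC divff ?gt_eqF // mul1r /w.
  by rewrite scalerBr scalerA mulrA scaleNr.
by congr (leb _); apply/seteqP; split => v; rewrite /= E.
Qed.

Lemma measurable_slices k n (K : set 'rV[R]_n) (U : 'M[R]_(k, n)) (e d : 'rV[R]_n) (s : R) :
  measurable_rV K ->
  measurable_fun setT (fun x : RT =>
    leb [set v | K (x *: e + (- (x * s)) *: d + v *m U)]).
Proof.
move=> mK.
pose W : 'M[R]_(1 + k, n) := col_mx (e - s *: d) U.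
have mP : measurable_rV [set c : 'rV[R]_k.+1 | K (c *m W)].
  have := measurable_rV_affine_section W 0 mK.
  by congr measurable_rV; apply/seteqP; split => c /=; rewrite add0r.
apply: eq_measurable_fun (measurable_lebesgue_slice mP) => x _.
have E v : row_cons x v *m W = x *: e + (- (x * s)) *: d + v *m U.
  rewrite [LHS](mul_row_col x%:M v (e - s *: d) U) mul_scalar_mx.
  by rewrite scalerBr scalerA scaleNr.
by congr (leb _); apply/seteqP; split => v /=; rewrite E.
Qed.

Lemma orthogonal_pair_dim n (e b : 'rV[R]_n) :
  dot e e = 1 -> dot e b = 0 -> b != 0 -> (1 < n)%N.
Proof.
case: n => [|[|//]] in e b *.
  by rewrite [b]thinmx0 eqxx.
rewrite /dot !big_ord1 => ee /eqP; rewrite mulf_eq0 => /orP[/eqP e0|/eqP b0].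
  by move: ee; rewrite e0 mul0r => /eqP; rewrite eq_sym oner_eq0.
by case/eqP; apply/rowP => i; rewrite ord1 mxE.
Qed.

(** The map x |-> 2 <x, e> e - x fixes e and is -1 on its orthogonal complement, so
    the slices of K by the level sets of <., e> are symmetric, and the integrands
    given by [section_volume_slices] are compared pointwise. *)
Lemma reflection_section_mono n (K : set 'rV[R]_n) (e b : 'rV[R]_n) (s t : R) :
  compact K -> convex_set K ->
  (forall x, K x -> K ((2 * dot x e) *: e - x)) ->
  dot e e = 1 -> dot e b = 0 -> b != 0 -> `|s| <= `|t| ->
  (((norm2 (b + t *: e)%R)^-1)%:E *
     hyperplane_vol (b + t *: e)%R (K `&` orth (b + t *: e)%R) <=
   ((norm2 (b + s *: e)%R)^-1)%:E *
     hyperplane_vol (b + s *: e)%R (K `&` orth (b + s *: e)%R))%E.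
Proof.
move=> compK convK sym ee eb b0 st.
have n2 := orthogonal_pair_dim ee eb b0.
case: n => [|[|k]] in K e b compK convK sym ee eb b0 n2 *; [by [] | by [] |].
have mK := compact_measurable_rV compK.
have [U [UU UA]] := @exists_orthonormal R k (1 + 1)%N k.+2 (col_mx e b) (eq_leq (addn2 k)).
move: UA; rewrite tr_col_mx mul_mx_row -row_mx0 => /eq_row_mx [Ue Ub].
rewrite !(section_volume_slices _ mK ee eb b0 UU Ue Ub).
have bb0 : 0 < dot b b by rewrite lt_def dot_eq0 b0 dot_ge0.
apply: lee_wpmul2l; first by rewrite lee_fin invr_ge0 ltW // norm2_gt0.
apply: ge0_le_integral => //.
- apply: eq_measurable_fun (measurable_slices U e b (t / dot b b) mK) => x _.
  by rewrite mulrA.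
- apply: eq_measurable_fun (measurable_slices U e b (s / dot b b) mK) => x _.
  by rewrite mulrA.
move=> x _; apply: brunn_symmetric => //; last first.
  rewrite !normrN !normrM ler_pM2r ?normr_gt0 ?invr_eq0 ?gt_eqF //.
  by rewrite ler_wpM2l.
move=> u c /sym; congr K.
have Uce : dot (c *m U) e = 0 by rewrite dotE -mulmxA Ue mulmx0 mxE.
rewrite !dotDl !dotZl ee Uce [dot b e]dotC eb mulr0 !addr0 mulr1.
by rewrite mulr_natl mulr2n scalerDl !opprD !addrA addrK.
Qed.

End transfer.

(** * Majorization *)

Section majorization.
Context (R : realType).

Definition psum n (x : 'rV[R]_n) (l : nat) : R := \sum_(i < n | (i < l)%N) x 0 i.

(** The effect of a transfer from the larger to the smaller of two coordinates; the
    condition on absolute values allows the two coordinates to be exchanged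
    as well. *)
Definition robin_hood_monotone n (phi : 'rV[R]_n -> \bar R) :=
  forall (y z : 'rV[R]_n) (j k : 'I_n), j != k ->
  nonneg_orthant y -> nonneg_orthant z -> y != 0 ->
  (forall i, i != j -> i != k -> z 0 i = y 0 i) ->
  z 0 j + z 0 k = y 0 j + y 0 k ->
  `|z 0 j - z 0 k| <= `|y 0 j - y 0 k| -> (phi y <= phi z)%E.


Lemma nonneg_neq0_sum n (y : 'rV[R]_n) : nonneg_orthant y ->
  (y != 0) = (0 < \sum_i y 0 i).
Proof.
move=> y0; rewrite lt_def sumr_ge0 ?andbT //; congr negb.
rewrite psumr_eq0 //; apply/eqP/allP => [-> i _|yz]; first by rewrite mxE eqxx.
by apply/rowP => i; rewrite mxE; apply/eqP; apply: yz; rewrite mem_index_enum.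
Qed.

(** Induction on the number of coordinates where x and y differ. Let k be the first
    index with x_k > y_k, and j the last index before k with x_j < y_j. Then
    y_j > x_j >= x_k > y_k, and moving the amount delta, the smaller of y_j - x_j
    and x_k - y_k, from y_j to y_k is a transfer after which one more coordinate
    agrees with x. The partial sums still dominate those of x because x and y agree
    strictly between j and k. Only x is sorted, which spares reordering y after each
    transfer. *)
Lemma sorted_psum_le n (phi : 'rV[R]_n -> \bar R) (x y : 'rV[R]_n) :
  robin_hood_monotone phi ->
  nonneg_orthant x -> nonneg_orthant y -> y != 0 ->
  {homo (fun i : 'I_n => x 0 i) : i j / (i <= j)%N >-> j <= i} ->
  \sum_i x 0 i = \sum_i y 0 i ->
  (forall l, psum x l <= psum y l) -> (phi y <= phi x)%E.
Proof.
move=> phiT x0 + + xs.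
have [d] := ubnP #|[pred i | x 0 i != y 0 i]|.
elim: d y => // d IH y yd y0 yn0 xy psxy.
have [->//|xney] := eqVneq x y.
have [k0 yxk0] : exists k : 'I_n, y 0 k < x 0 k.
  apply: contrapT => /forallNP no.
  have le i : true -> x 0 i <= y 0 i by move=> _; rewrite leNgt; apply/negP; exact: no.
  have /leif_sum : forall i : 'I_n, true -> x 0 i <= y 0 i ?= iff (x 0 i == y 0 i).
    by move=> i _; split => //; exact: le.
  case=> _; rewrite xy eqxx => /esym /forallP eqxy.
  by case/eqP: xney; apply/rowP => i; apply/eqP; exact: eqxy.
pose k := [arg min_(k < k0 | y 0 k < x 0 k) (k : nat)].
have [yxk kmin] : y 0 k < x 0 k /\ forall i : 'I_n, (i < k)%N -> x 0 i <= y 0 i.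
  rewrite /k; case: arg_minnP => // k' h1 h2; split => // i ik.
  by rewrite leNgt; apply: contraL ik => /h2; rewrite -leqNgt.
have [j0 /andP[j0k xyj0]] : exists j : 'I_n, (j < k)%N && (x 0 j < y 0 j).
  apply: contrapT => /forallNP no.
  have eqi (i : 'I_n) : (i < k)%N -> x 0 i = y 0 i.
    move=> ik; apply/eqP; rewrite eq_le kmin //= leNgt; apply/negP => h.
    by apply: (no i); rewrite ik.
  have := psxy k.+1; rewrite /psum (bigD1 k) ?ltnS //= [leRHS](bigD1 k) ?ltnS //=.
  have -> : \sum_(i < n | (i < k.+1)%N && (i != k)) x 0 i =
            \sum_(i < n | (i < k.+1)%N && (i != k)) y 0 i.
    by apply: eq_bigr => i /andP[ik nk]; apply: eqi; rewrite ltn_neqAle nk.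
  by rewrite lerD2r leNgt yxk.
pose j := [arg max_(j > j0 | (j < k)%N && (x 0 j < y 0 j)) (j : nat)].
have [jk xyj jmax] : [/\ (j < k)%N, x 0 j < y 0 j &
    forall i : 'I_n, (j < i < k)%N -> x 0 i = y 0 i].
  rewrite /j; case: arg_maxnP => [|j' /andP[h1 h2] h3]; first by rewrite j0k.
  split => // i /andP[ji ik]; apply/eqP; rewrite eq_le kmin //= leNgt.
  apply: contraL ji => xyi; rewrite -leqNgt.
  by apply: h3; rewrite ik.
have njk : j != k by apply: contraL jk => /eqP ->; rewrite ltnn.
have xkj : x 0 k <= x 0 j by apply: xs; exact: ltnW.
pose delta := Num.min (y 0 j - x 0 j) (x 0 k - y 0 k).
have d1 : delta <= y 0 j - x 0 j by rewrite ge_min lexx.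
have d2 : delta <= x 0 k - y 0 k by rewrite ge_min lexx orbT.
have d0 : 0 < delta by rewrite lt_min !subr_gt0 xyj.
pose z : 'rV[R]_n := \row_i (y 0 i - delta *+ (i == j) + delta *+ (i == k)).
have zj : z 0 j = y 0 j - delta by rewrite mxE eqxx (negPf njk) addr0.
have zk : z 0 k = y 0 k + delta by rewrite mxE eqxx eq_sym (negPf njk) subr0.
have zi i : i != j -> i != k -> z 0 i = y 0 i.
  by move=> /negPf ij /negPf ik; rewrite mxE ij ik subr0 addr0.
have z0 : nonneg_orthant z.
  move=> i; have [->|ij] := eqVneq i j.
    by rewrite zj; have := x0 j; move: d1; lra.
  have [->|ik] := eqVneq i k; first by rewrite zk; have := y0 k; move: d0; lra.
  by rewrite zi.
have sumz : \sum_i z 0 i = \sum_i y 0 i.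
  rewrite (bigD1 j) //= (bigD1 k) //=; last by rewrite eq_sym.
  rewrite [RHS](bigD1 j) //= [X in _ = _ + X](bigD1 k) //=; last by rewrite eq_sym.
  rewrite zj zk !addrA; congr (_ + _); first by ring.
  by apply: eq_bigr => i /andP[? ?]; exact: zi.
apply: (@le_trans _ _ (phi z)).
  apply: (phiT y z j k) => //.
  - by rewrite zj zk; ring.
  - rewrite zj zk !ger0_norm; move: d1 d2 d0 xkj; lra.
apply: IH => //.
- apply: leq_trans (yd : (_ <= d)%N); apply: proper_card; apply/properP; split.
    apply/fintype.subsetP => i; rewrite !inE; apply: contraNneq => xyi.
    have ij : i != j by apply: contraTneq xyj => <-; rewrite -xyi ltxx.
    have ik : i != k by apply: contraTneq yxk => <-; rewrite -xyi ltxx.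
    by rewrite zi // xyi.
  have [dE|dE] : delta = y 0 j - x 0 j \/ delta = x 0 k - y 0 k.
    by rewrite /delta; case: leP; [left|right].
  - exists j; rewrite !inE; first by rewrite lt_eqF.
    by rewrite zj dE subKr eqxx.
  - exists k; rewrite !inE; first by rewrite gt_eqF.
    by rewrite zk dE addrC subrK eqxx.
- by rewrite nonneg_neq0_sum // sumz -nonneg_neq0_sum.
- by rewrite xy sumz.
- move=> l.
  have psz : psum z l = psum y l - delta *+ (j < l)%N + delta *+ (k < l)%N.
    have ind (p : 'I_n) : \sum_(i < n | (i < l)%N) delta *+ (i == p) = delta *+ (p < l)%N.
      have [pl|pl] := boolP (p < l)%N.
        rewrite (bigD1 p) //= eqxx big1 ?addr0 // => i /andP[_ /negPf ->].
        by rewrite mulr0n.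
      rewrite big1 ?mulr0n // => i il; case: eqVneq => // ip.
      by rewrite -ip il in pl.
    rewrite -!ind /psum -sumrB -big_split /=.
    by apply: eq_bigr => i _; rewrite mxE.
  rewrite psz; have [jl|lj] := ltnP j l; last first.
    have -> : (k < l)%N = false by apply/negbTE; rewrite -leqNgt (leq_trans lj) // ltnW.
    by rewrite !mulr0n subr0 addr0.
  have [kl|lk] := ltnP k l; first by rewrite subrK.
  rewrite mulr0n addr0 mulr1n lerBrDl -lerBrDr.
  rewrite /psum -sumrB (bigD1 j) //= ler_wpDr //.
  rewrite (bigID (fun i : 'I_n => (i < j)%N)) /= addr_ge0 //.
    rewrite (eq_bigl (fun i : 'I_n => (i < j)%N)); last first.
      move=> i; rewrite andbC; have [ij|//] := ltnP i j.
      by rewrite (ltn_trans ij) //= -val_eqE /= ltn_eqF.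
    by rewrite sumrB subr_ge0; exact: psxy.
  rewrite big1 // => i /andP[/andP[il ij]]; rewrite -leqNgt => ji.
  rewrite jmax ?subrr // (leq_trans il lk) andbT ltn_neqAle ji andbT eq_sym.
  exact: ij.
Qed.

Lemma rearr_perm n (x : 'rV[R]_n) : exists s : 'S_n,
  forall i : 'I_n, (rearr x)`_i = col_perm s x 0 i.
Proof.
have : perm_eq (rearr x) [tuple x 0 i | i < n].
  by rewrite perm_sort.
move=> /tuple_permP[s sE]; exists s => i.
by rewrite sE mxE -tnth_nth !tnth_mktuple.
Qed.

Lemma rearr_sorted n (x y : 'rV[R]_n) : (forall i : 'I_n, (rearr x)`_i = y 0 i) ->
  {homo (fun i : 'I_n => y 0 i) : i j / (i <= j)%N >-> j <= i}.
Proof.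
move=> xy i j ij; rewrite -!xy.
have sz : size (rearr x) = n by rewrite size_sort size_map size_enum_ord.
have ge_trans : transitive (fun a b : R => b <= a).
  by move=> a b c /= ba cb; exact: le_trans cb ba.
have srt : sorted (fun a b : R => b <= a) (rearr x).
  by apply: sort_sorted => a b /=; exact: le_total.
by apply: (sorted_leq_nth ge_trans _ 0 srt); rewrite ?inE ?sz.
Qed.

Lemma majorized_schur n (phi : 'rV[R]_n -> \bar R) : (0 < n)%N ->
  robin_hood_monotone phi ->
  (forall (s : 'S_n) x, x != 0 -> phi (col_perm s x) = phi x) ->
  schur_concave (@nonneg_orthant R n `\ 0) phi.
Proof.
move=> n0 phiT phiP x y [x0 /= /eqP xn0] [y0 /= /eqP yn0] [sumxy part].
have [s sE] := rearr_perm x; have [t tE] := rearr_perm y.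
rewrite -(phiP s x) // -(phiP t y) //.
have perm0 (u : 'S_n) (v : 'rV[R]_n) : nonneg_orthant v -> nonneg_orthant (col_perm u v).
  by move=> v0 i; rewrite mxE.
have permsum (u : 'S_n) (v : 'rV[R]_n) : \sum_i col_perm u v 0 i = \sum_i v 0 i.
  under eq_bigr do rewrite mxE.
  by rewrite [RHS](reindex_inj (@perm_inj _ u)).
have sumst : \sum_i col_perm s x 0 i = \sum_i col_perm t y 0 i by rewrite !permsum.
apply: sorted_psum_le => //; try exact: perm0.
- by rewrite nonneg_neq0_sum ?permsum -?nonneg_neq0_sum //; exact: perm0.
- exact: rearr_sorted sE.
move=> l; have [ln|nl] := leqP l n.-1.
  have psE (z w : 'rV[R]_n) : (forall i : 'I_n, (rearr z)`_i = w 0 i) ->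
      psum w l = \sum_(i < l) (rearr z)`_i.
    move=> zw; rewrite (big_ord_widen n (fun i => (rearr z)`_i)).
      by apply: eq_bigr => i _; rewrite zw.
    by rewrite (leq_trans ln) // leq_pred.
  by rewrite (psE x) // (psE y) //; exact: part.
have psE (w : 'rV[R]_n) : psum w l = \sum_i w 0 i.
  apply: eq_bigl => i; rewrite (leq_trans (ltn_ord i)) //.
  by rewrite -(prednK n0).
by rewrite !psE sumst.
Qed.

End majorization.

(** * Symmetric bodies and the theorem *)

Section symmetric_body.
Context (R : realType).
Notation leb := (@lebesgue_rV R _).

Lemma dot_mulmx n (Q : 'M[R]_n) (x y : 'rV[R]_n) : Q *m Q^T = 1%:M ->
  dot (x *m Q) (y *m Q) = dot x y.
Proof. by move=> QQ; rewrite !dotE trmx_mul mulmxA -(mulmxA x) QQ mulmx1. Qed.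

Lemma hyperplane_vol_isometry n (K : set 'rV[R]_n) (Q : 'M[R]_n) (a : 'rV[R]_n) :
  measurable_rV K -> Q *m Q^T = 1%:M -> (forall x, K x -> K (x *m Q)) ->
  (forall x, K (x *m Q) -> K x) -> a != 0 ->
  hyperplane_vol (a *m Q) (K `&` orth (a *m Q)) = hyperplane_vol a (K `&` orth a).
Proof.
move=> mK QQ KQ KQ' a0.
have n0 : (0 < n)%N by case: n a a0 {Q QQ KQ KQ' mK K} => // a; rewrite thinmx0 eqxx.
have [HH Ha] := hframe_spec a n0; set H := hframe a in HH Ha *.
rewrite (central_hyperplane_vol mK a0 HH Ha).
rewrite (@central_hyperplane_vol _ _ K (a *m Q) (H *m Q) mK).
- by congr (leb _); apply/seteqP; split => c; rewrite /= mulmxA; [exact: KQ' | exact: KQ].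
- by rewrite -dot_eq0 dot_mulmx // dot_eq0.
- by rewrite trmx_mul mulmxA -(mulmxA H) QQ mulmx1 HH.
- by rewrite trmx_mul mulmxA -(mulmxA H) QQ mulmx1 Ha.
Qed.

Variables (n : nat) (K : set 'rV[R]_n).
Hypotheses (K_body : convex_body K) (K_sym : one_symmetric K).

Let compK : compact K. Proof. by case: K_body. Qed.
Let convK : convex_set K. Proof. by case: K_body. Qed.
Let mK : measurable_rV K. Proof. exact: compact_measurable_rV. Qed.

Definition sign_vec (b : 'I_n -> bool) : 'rV[R]_n := \row_i (-1) ^+ b i.

Lemma sign_stable (b : 'I_n -> bool) x : K x -> K (x *m diag_mx (sign_vec b)).
Proof.
move=> Kx.
have step (s : seq 'I_n) : uniq s ->
    K (\row_i ((-1) ^+ (i \in s) * x 0 i)).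
  elim: s => [_|j s IH /= /andP[js us]].
    by congr K: Kx; apply/rowP => i; rewrite mxE mul1r.
  case: K_sym => /(_ j) <- _; exists (\row_i ((-1) ^+ (i \in s) * x 0 i)); first exact: IH.
  apply/rowP => i; rewrite !mxE inE; case: eqVneq => [->|//].
  by rewrite (negPf js) /= mul1r mulN1r.
have := step (enum [pred i | b i]) (enum_uniq _).
congr K; apply/rowP => i; rewrite mul_mx_diag !mxE mem_enum inE mulrC.
by [].
Qed.

Lemma opp_stable x : K x -> K (- x).
Proof.
move=> /(@sign_stable xpredT); congr K; apply/rowP => i.
by rewrite mul_mx_diag !mxE expr1 mulrN1.
Qed.

Lemma perm_stable (s : 'S_n) x : K x -> K (col_perm s x).
Proof. by move=> Kx; case: K_sym => _ /(_ s) <-; exists x. Qed.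

Lemma V_isometry (Q : 'M[R]_n) a : Q *m Q^T = 1%:M ->
  (forall x, K x -> K (x *m Q)) -> (forall x, K (x *m Q) -> K x) ->
  norm1 (a *m Q) = norm1 a -> a != 0 -> V K (a *m Q) = V K a.
Proof.
move=> QQ KQ KQ' aQ a0; rewrite /V aQ hyperplane_vol_isometry //.
by rewrite /norm2 dot_mulmx.
Qed.

Lemma V_perm (s : 'S_n) a : a != 0 -> V K (col_perm s a) = V K a.
Proof.
move=> a0.
have QQ : perm_mx s^-1 *m (perm_mx s^-1)^T = 1%:M :> 'M[R]_n.
  by rewrite tr_perm_mx invgK -perm_mxM mulVg perm_mx1.
have E x : col_perm s x = x *m perm_mx s^-1 by rewrite col_permE.
rewrite E; apply: V_isometry => //.
- by move=> x Kx; rewrite -E; exact: perm_stable.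
- move=> x; rewrite -E => /(@perm_stable s^-1).
  by congr K; apply/rowP => i; rewrite 2!mxE permKV.
- rewrite -E /norm1; under eq_bigr do rewrite mxE.
  by rewrite [RHS](reindex_inj (@perm_inj _ s)).
Qed.

Definition abs_vec (a : 'rV[R]_n) : 'rV[R]_n := \row_i `|a 0 i|.

Lemma V_abs a : a != 0 -> V K (abs_vec a) = V K a.
Proof.
move=> a0; pose b i := a 0 i < 0.
have aE : abs_vec a = a *m diag_mx (sign_vec b).
  apply/rowP => i; rewrite mul_mx_diag !mxE mulrC.
  by rewrite normrEsign.
have DD : diag_mx (sign_vec b) *m diag_mx (sign_vec b) = 1%:M.
  rewrite mulmx_diag -diag_const_mx; congr diag_mx; apply/rowP => i.
  by rewrite !mxE -signr_addb addbb.
rewrite aE; apply: V_isometry => //.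
- by rewrite tr_diag_mx DD.
- by move=> x; exact: sign_stable.
- by move=> x /(@sign_stable b); rewrite -mulmxA DD mulmx1.
- by rewrite -aE; apply: eq_bigr => i _; rewrite mxE normr_id.
Qed.

(** The vector y with its coordinates j, k replaced by their mean is b, and both y
    and z lie on the line b + R e. On K the reflection attached to e is the exchange
    of the two coordinates followed by central symmetry. *)
Lemma V_robin_hood : robin_hood_monotone (V K).
Proof.
move=> y z j k jk y0 z0 yn0 zy szy dzy.
pose c : R := Num.sqrt 2 / 2.
have cc : c * c = 1 / 2.
  by rewrite /c mulrACA -expr2 sqr_sqrtr //; field.
have c0 : c != 0.
  by apply: contra_eq_neq cc => ->; rewrite mul0r; lra.
pose e : 'rV[R]_n := \row_i (c *+ (i == j) - c *+ (i == k)).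
have ej : e 0 j = c by rewrite mxE eqxx (negPf jk) subr0.
have ek : e 0 k = - c by rewrite mxE eqxx eq_sym (negPf jk) sub0r.
have ei i : i != j -> i != k -> e 0 i = 0.
  by move=> /negPf ij /negPf ik; rewrite mxE ij ik subr0.
have dote x : dot x e = c * (x 0 j - x 0 k).
  rewrite /dot (bigD1 j) //= (bigD1 k) ?(eq_sym k) //= ej ek.
  rewrite big1 ?addr0; first by ring.
  by move=> i /andP[? ?]; rewrite ei ?mulr0.
(* The common value of the two coordinates of b. *)
pose m := (y 0 j + y 0 k) / 2.
pose b : 'rV[R]_n := \row_i (if (i == j) || (i == k) then m else y 0 i).
have bj : b 0 j = m by rewrite mxE eqxx.
have bk : b 0 k = m by rewrite mxE eqxx orbT.
have bi i : i != j -> i != k -> b 0 i = y 0 i.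
  by move=> /negPf ij /negPf ik; rewrite mxE ij ik.
have decomp (w : 'rV[R]_n) : (forall i, i != j -> i != k -> w 0 i = y 0 i) ->
    w 0 j + w 0 k = y 0 j + y 0 k -> w = b + (c * (w 0 j - w 0 k)) *: e.
  move=> wy sw; apply/rowP => i.
  have lin (u v : 'rV[R]_n) t : (u + t *: v) 0 i = u 0 i + t * v 0 i by rewrite !mxE.
  rewrite lin; have [->|ij] := eqVneq i j.
    by rewrite bj ej mulrAC cc /m -sw; field.
  have [->|ik] := eqVneq i k; first by rewrite bk ek mulrN mulrAC cc /m -sw; field.
  by rewrite bi // ei // mulr0 addr0 wy.
(* Nonnegativity is what keeps b from vanishing when y != 0. *)
have b0 : b != 0.
  apply: contraNneq yn0 => b0; apply/eqP/rowP => i; rewrite [RHS]mxE.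
  have m0 : m = 0 by rewrite -bj b0 mxE.
  have [yj yk] := (y0 j, y0 k); rewrite /= in yj yk.
  have [->|ij] := eqVneq i j; first by move: m0; rewrite /m; lra.
  have [->|ik] := eqVneq i k; first by move: m0; rewrite /m; lra.
  by rewrite -bi // b0 mxE.
have swapK x : K x -> K ((2 * dot x e) *: e - x).
  move=> /(@perm_stable (tperm j k)) /opp_stable; congr K; apply/rowP => i.
  have lin (u v : 'rV[R]_n) t : (t *: u - v) 0 i = t * u 0 i - v 0 i by rewrite !mxE.
  rewrite lin dote mxE [col_perm _ _ _ _]mxE.
  case: tpermP => [->|->|/eqP ij /eqP ik]; last by rewrite ei // mulr0 sub0r.
  - rewrite ej (_ : 2 * (c * (x 0 j - x 0 k)) * c = 2 * (c * c) * (x 0 j - x 0 k)); last by ring.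
    by rewrite cc; field.
  - rewrite ek (_ : 2 * (c * (x 0 j - x 0 k)) * - c = - (2 * (c * c) * (x 0 j - x 0 k))); last by ring.
    by rewrite cc; field.
have ee : dot e e = 1 by rewrite dote ej ek opprK mulrDr cc; field.
have eb : dot e b = 0 by rewrite dotC dote bj bk subrr mulr0.
have n1 : norm1 y = norm1 z.
  have absE (w : 'rV[R]_n) : nonneg_orthant w -> norm1 w = \sum_i w 0 i.
    by move=> w0; apply: eq_bigr => i _; rewrite ger0_norm.
  rewrite !absE // (bigD1 j) //= (bigD1 k) ?(eq_sym k) //= addrA -szy.
  rewrite [RHS](bigD1 j) //= [X in _ = _ + X](bigD1 k) ?(eq_sym k) //= [RHS]addrA.
  by congr (_ + _); apply: eq_bigr => i /andP[? ?]; rewrite zy.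
rewrite /V n1 ![(_ / _)%:E]EFinM -!muleA.
apply: lee_wpmul2l; first by rewrite lee_fin sumr_ge0.
rewrite {1 2 3}(decomp y) // {1 2 3}(decomp z) //.
by apply: reflection_section_mono => //; rewrite !normrM ler_wpM2l.
Qed.

(** Sections at heights t and - t are opposite to each other. *)
Lemma V_shift_le a t : a != 0 -> (V_shift K a t <= V K a)%E.
Proof.
move=> a0.
have n0 : (0 < n)%N by case: (n) a a0 => // a; rewrite thinmx0 eqxx.
have [HH Ha] := hframe_spec a n0.
rewrite /V_shift /V; apply: lee_wpmul2l.
  by rewrite lee_fin divr_ge0 ?sqrtr_ge0 // sumr_ge0.
rewrite (hyperplane_vol_frame t mK a0 HH Ha) (central_hyperplane_vol mK a0 HH Ha).
have := @brunn_symmetric R _ n K (hframe a) 0 a 0 t compK convK HH.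
have -> : [set c | K (0 + t *: a + c *m hframe a)] = [set c | K (t *: a + c *m hframe a)].
  by apply/seteqP; split => c /=; rewrite add0r.
have -> : [set c | K (0 + 0 *: a + c *m hframe a)] = [set c | K (c *m hframe a)].
  by apply/seteqP; split => c /=; rewrite scale0r !add0r.
apply; last by rewrite normr0.
by move=> u c /opp_stable; rewrite !opprD oppr0.
Qed.

Lemma V_shift0 a : V_shift K a 0 = V K a.
Proof. by rewrite /V_shift scale0r translate0. Qed.

Lemma ereal_sup_max (S : set (\bar R)) m : S m -> ubound S m -> ereal_sup S = m.
Proof.
move=> Sm ub; apply/eqP; rewrite eq_le ge_ereal_sup //=.
exact: ereal_sup_ubound.
Qed.

Lemma beta_at_max a : a != 0 ->
  is_max [set V_shift K a t | t in [set: R]] (beta_at K a) /\ beta_at K a = V K a.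
Proof.
move=> a0.
have mem : [set V_shift K a t | t in [set: R]] (V K a) by exists 0; rewrite ?V_shift0.
have ub : ubound [set V_shift K a t | t in [set: R]] (V K a).
  by move=> _ [t _ <-]; exact: V_shift_le.
by rewrite /beta_at (ereal_sup_max mem ub).
Qed.

Lemma const_neq0 (c : R) : (0 < n)%N -> c != 0 -> const_mx c != 0 :> 'rV[R]_n.
Proof.
move=> n0; apply: contra_neq => /rowP /(_ (Ordinal n0)).
by rewrite !mxE.
Qed.

Lemma V_const (c : R) : (0 < n)%N -> 0 < c ->
  V K (const_mx c) = ((Num.sqrt n%:R)%:E *
     hyperplane_vol (const_mx 1%R : 'rV[R]_n) (K `&` orth (const_mx 1%R)))%E.
Proof.
move=> n0 c0.
have u0 : const_mx 1 != 0 :> 'rV[R]_n by rewrite const_neq0 // oner_eq0.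
have cu0 : const_mx c != 0 :> 'rV[R]_n by rewrite const_neq0 // gt_eqF.
have [HH Ha] := hframe_spec (const_mx 1 : 'rV[R]_n) n0.
have cE : const_mx c = c *: const_mx 1 :> 'rV[R]_n by apply/rowP => i; rewrite !mxE mulr1.
rewrite /V (central_hyperplane_vol mK u0 HH Ha) (central_hyperplane_vol mK cu0 HH); last first.
  by rewrite cE linearZ /= -scalemxAr Ha scaler0.
congr (_%:E * _)%E.
have -> : norm1 (const_mx c : 'rV[R]_n) = n%:R * c.
  rewrite /norm1; under eq_bigr do rewrite mxE gtr0_norm //.
  by rewrite sumr_const card_ord mulr_natl.
have -> : norm2 (const_mx c : 'rV[R]_n) = Num.sqrt n%:R * c.
  rewrite /norm2 /dot; under eq_bigr do rewrite mxE -expr2.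
  by rewrite sumr_const card_ord -[c ^+ 2 *+ n]mulr_natl sqrtrM ?ler0n // sqrtr_sqr gtr0_norm.
have sn0 : 0 < Num.sqrt n%:R :> R by rewrite sqrtr_gt0 ltr0n.
rewrite -{1}(@sqr_sqrtr _ n%:R) ?ler0n //; field.
by rewrite !gt_eqF.
Qed.

(** Either the first l entries of y are all at least the mean c, or all the entries
    from index l on are below c; then their deficit is compensated by the first l
    entries. *)
Lemma sorted_mean_psum (y : 'rV[R]_n) (c : R) :
  {homo (fun i : 'I_n => y 0 i) : i j / (i <= j)%N >-> j <= i} ->
  \sum_(i < n) c = \sum_i y 0 i ->
  forall l, psum (const_mx c : 'rV[R]_n) l <= psum y l.
Proof.
move=> ys cy l; rewrite -subr_ge0 /psum -sumrB.
under eq_bigr do rewrite [const_mx c _ _]mxE.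
have [/forallP h|] := boolP [forall i : 'I_n, (i < l)%N ==> (c <= y 0 i)].
  by apply: sumr_ge0 => i il; rewrite subr_ge0; exact: (implyP (h i)).
rewrite negb_forall => /existsP[i0]; rewrite negb_imply -ltNge => /andP[i0l yc].
have : \sum_i (y 0 i - c) = 0 by rewrite sumrB cy subrr.
rewrite (bigID (fun i : 'I_n => (i < l)%N)) /=.
have : \sum_(i < n | ~~ (i < l)%N) (y 0 i - c) <= 0.
  apply: sumr_le0 => i; rewrite -leqNgt => li; rewrite subr_le0.
  by apply: le_trans (ltW yc); apply: ys; exact: leq_trans (ltnW i0l) li.
by lra.
Qed.

Lemma V_le_const a : (0 < n)%N -> a != 0 -> (V K a <= V K (const_mx 1%R))%E.
Proof.
move=> n0 a0.
have [s sE] := rearr_perm (abs_vec a).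
have abs0 : nonneg_orthant (abs_vec a) by move=> i; rewrite mxE.
have absn0 : abs_vec a != 0.
  apply: contraNneq a0 => /rowP h; apply/eqP/rowP => i.
  by have := h i; rewrite !mxE => /eqP; rewrite normr_eq0 => /eqP.
rewrite -V_abs // -(V_perm s) //.
set y := col_perm s _.
have y0 : nonneg_orthant y by move=> i; rewrite mxE.
have yn0 : y != 0.
  apply: contraNneq absn0 => /rowP h; apply/eqP/rowP => i.
  by have := h (s^-1%g i); rewrite mxE permKV !mxE.
have sum0 : 0 < \sum_i y 0 i by rewrite -nonneg_neq0_sum.
pose c := (\sum_i y 0 i) / n%:R.
have nR : 0 < n%:R :> R by rewrite ltr0n.
have c0 : 0 < c by rewrite divr_gt0.
have sumc : \sum_(i < n) c = \sum_i y 0 i.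
  by rewrite sumr_const card_ord -mulr_natr divfK // gt_eqF.
rewrite (V_const n0 ltr01) -(V_const n0 c0).
apply: (sorted_psum_le V_robin_hood) => //.
- by move=> i; rewrite mxE ltW.
- by move=> i j _; rewrite !mxE.
- by under eq_bigr do rewrite mxE.
- by apply: sorted_mean_psum => //; exact: rearr_sorted sE.
Qed.

Lemma beta_max : (0 < n)%N ->
  is_max [set beta_at K a | a in ~` [set (0 : 'rV[R]_n)]] (beta K) /\
  beta K = V K (const_mx 1).
Proof.
move=> n0.
have u0 : const_mx 1 != 0 :> 'rV[R]_n by rewrite const_neq0 // oner_eq0.
have mem : [set beta_at K a | a in ~` [set (0 : 'rV[R]_n)]] (V K (const_mx 1)).
  by exists (const_mx 1); [exact/eqP | case: (beta_at_max u0)].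
have ub : ubound [set beta_at K a | a in ~` [set (0 : 'rV[R]_n)]] (V K (const_mx 1)).
  move=> _ [a /= /eqP a0 <-]; have [_ ->] := beta_at_max a0.
  exact: V_le_const.
by rewrite /beta (ereal_sup_max mem ub).
Qed.


End symmetric_body.

Theorem theorem1 (R : realType) (n : nat) (n_gt0 : (0 < n)%N)
    (K : set 'rV[R]_n) (K_body : convex_body K) (K_sym : one_symmetric K) :
  [/\ schur_concave (@nonneg_orthant R n `\ 0) (V K),
      (forall a : 'rV[R]_n, a != 0 ->
         is_max [set V_shift K a t | t in [set: R]] (beta_at K a)),
      is_max [set beta_at K a | a in ~` [set (0 : 'rV[R]_n)]] (beta K) &
      beta K = ((Num.sqrt n%:R)%:E *
                hyperplane_vol (const_mx 1%R : 'rV[R]_n)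
                  (K `&` orth (const_mx 1%R)))%E].
Proof.
have [bmax bE] := beta_max K_body K_sym n_gt0.
split => //.
- apply: majorized_schur => //; first exact: V_robin_hood.
  by move=> s x; exact: V_perm.
- by move=> a a0; case: (beta_at_max K_body K_sym a0).
- by rewrite bE V_const.
Qed.
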